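(* Let $(\mathscr{A},\tau)$ be a $W^\star$-non commutative probability space, let $P\in\mathscr{A}$ be an orthogonal projection with $\tau(P)=\theta\in(0,1)$, and let $Y=(Y_t)_{t\ge 0}\subset\mathscr{A}$ be a free unitary Brownian motion that is $\star$-free from $P$. Then for every $t>0$ the orthogonal projections $P$ and $Y_tPY_t^\star$ are in general position, that is $$\tau\big(P\wedge (Y_tPY_t^\star)\big)=\max\big(\tau(P)+\tau(Y_tPY_t^\star)-1,0\big)=\max(2\theta-1,0).$$
   Context: A $W^\star$-non commutative probability space $(\mathscr{A},\tau)$ is a von Neumann algebra $\mathscr{A}$ with unit ${\bf 1}$ endowed with a faithful (normal) tracial state $\tau$. A free unitary Brownian motion $Y=(Y_t)_{t\ge0}$ is a family of unitaries in $\mathscr{A}$ with $Y_0={\bf 1}$, with stationary $\star$-free multiplicative increments (i.e. for $0\le t_1<\dots<t_n$ the elements $Y_{t_1},Y_{t_2}Y_{t_1}^\star,\dots,Y_{t_n}Y_{t_{n-1}}^\star$ are $\star$-free and $Y_tY_s^\star$ has the law of $Y_{t-s}$ for $s<t$), and with moments $\tau(Y_t^k)=\tau((Y_t^\star)^k)=e^{-kt/2}\frac1k L^{(1)}_{k-1}(kt)$, $k\ge1$, where $L^{(1)}_{n}$ is the $n$-th Laguerre polynomial of parameter $1$ (in particular $\tau(Y_t)=e^{-t/2}$). For two orthogonal projections $P_1,P_2\in\mathscr{A}$ with ranges $H_1,H_2$, $P_1\wedge P_2$ denotes the orthogonal projection onto $H_1\cap H_2$. *)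

(* Defs.v *)
From HB Require Import structures.
From mathcomp Require Import all_boot all_order all_algebra.
From mathcomp Require Import complex.
From mathcomp Require Import all_classical all_reals all_analysis.

Set Implicit Arguments.
Unset Strict Implicit.
Unset Printing Implicit Defensive.

Import Order.TTheory GRing.Theory Num.Theory.
Import numFieldNormedType.Exports.

Local Open Scope classical_set_scope.
Local Open Scope complex_scope.
Local Open Scope ring_scope.

(** A complex Hilbert space is a complete normed space over [R[i]] whose norm
    comes from an inner product [dot], linear in its first argument. Operators
    are plain functions [H -> H], composed by [\o]; [bounded_op] singles out
    the elements of B(H). *)

Section WstarProbability.
Context {R : realType} {H : completeNormedModType R[i]}.
Variable dot : {dot H for (@Num.conj R[i])}.

Implicit Types (x y a P Q : H -> H) (A B D M : set (H -> H)).

Definition hilbert_norm := forall v : H, `|v| ^+ 2 = dot v v.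

Definition bounded_op x :=
  linear x /\ exists C : R[i], forall v : H, `|x v| <= C * `|v|.

Definition is_adjoint x y := forall v w : H, dot (x v) w = dot v (y w).

(** The adjoint is unique when it exists, which by the Riesz theorem it does
    for bounded [x]; the default value [idfun] is then never used. *)
Definition adj x : H -> H := xget (idfun : H -> H) [set y | is_adjoint x y].

Definition self_adjoint x := is_adjoint x x.

Definition unitary x := adj x \o x = idfun /\ x \o adj x = idfun.

Definition orthogonal_projection x :=
  [/\ bounded_op x, x \o x = x & self_adjoint x].

(** The orthogonal projection onto [E]; it exists, and is unique, when [E] is a
    closed subspace. *)
Definition projection_onto (E : set H) : H -> H :=
  xget (idfun : H -> H) [set x | orthogonal_projection x /\ range x = E].

Definition meet_projection P Q : H -> H :=
  projection_onto (range P `&` range Q).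

(** Unital star-subalgebras of B(H). *)
Definition star_subalgebra A :=
  [/\ A `<=` bounded_op,
      A idfun,
      forall (c : R[i]) x y, A x -> A y -> A (fun v => c *: x v + y v),
      forall x y, A x -> A y -> A (x \o y) &
      forall x, A x -> exists2 y, A y & is_adjoint x y].

Definition commutant A : set (H -> H) :=
  [set x | bounded_op x /\ forall y, A y -> x \o y = y \o x].

(** By the bicommutant theorem, [M = M''] amounts to closedness in the weak
    operator topology. *)
Definition von_neumann_algebra M :=
  star_subalgebra M /\ commutant (commutant M) = M.

Definition op_le x y := forall v : H, 0 <= dot (y v - x v) v.

Definition is_lub_sa M D a :=
  [/\ M a, self_adjoint a, forall x, D x -> op_le x a &
      forall b, M b -> self_adjoint b -> (forall x, D x -> op_le x b) ->
        op_le a b].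

(** Compatibility with least upper bounds of bounded increasing nets. *)
Definition normal_functional M (tau : (H -> H) -> R[i]) :=
  forall D a, D !=set0 ->
    (forall x, D x -> M x /\ self_adjoint x) ->
    (forall x y, D x -> D y -> exists z, [/\ D z, op_le x z & op_le y z]) ->
    is_lub_sa M D a -> supremums (tau @` D) (tau a).

(** The values of [tau] outside [M] are irrelevant. *)
Record faithful_normal_tracial_state M (tau : (H -> H) -> R[i]) : Prop := {
  state_linear : forall (c : R[i]) x y, M x -> M y ->
    tau (fun v => c *: x v + y v) = c * tau x + tau y;
  state_unit : tau idfun = 1;
  state_ge0 : forall x, M x -> 0 <= tau (adj x \o x);
  state_faithful : forall x, M x ->
    tau (adj x \o x) = 0 -> x = (fun=> 0);
  state_tracial : forall x y, M x -> M y -> tau (x \o y) = tau (y \o x);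
  state_normal : normal_functional M tau }.

Record wstar_probability_space M (tau : (H -> H) -> R[i]) : Prop := {
  wstar_hilbert : hilbert_norm;
  wstar_von_neumann : von_neumann_algebra M;
  wstar_state : faithful_normal_tracial_state M tau }.

(** A family [S] of sets of operators is star-free when the star-algebras they
    generate are free: an alternating product of centered elements is centered.
    Only the first [n] values of [i] and [a] are relevant. *)
Definition star_free (tau : (H -> H) -> R[i]) (I : eqType)
    (S : I -> set (H -> H)) :=
  forall (n : nat) (i : nat -> I) (a : nat -> (H -> H)), (0 < n)%N ->
    (forall k, (k.+1 < n)%N -> i k != i k.+1) ->
    (forall k, (k < n)%N ->
       smallest star_subalgebra (S (i k)) (a k) /\ tau (a k) = 0) ->
    tau (\big[comp/idfun]_(0 <= k < n) a k) = 0.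

Definition star_word (w : seq bool) x : H -> H :=
  \big[comp/idfun]_(b <- w) (if b then x else adj x).

Definition same_star_law (tau : (H -> H) -> R[i]) x y :=
  forall w : seq bool, tau (star_word w x) = tau (star_word w y).

(** Laguerre polynomial of degree [n] and parameter 1:
    L_n^(1)(s) = sum_j (-1)^j binom(n+1, n-j) s^j / j!. *)
Definition laguerre1 (n : nat) (s : R) : R :=
  \sum_(j < n.+1) (-1) ^+ j * 'C(n.+1, n - j)%:R * s ^+ j / j`!%:R.

Definition increment (Y : R -> H -> H) (t : nat -> R) (k : nat) : H -> H :=
  if k is j.+1 then Y (t k) \o adj (Y (t j)) else Y (t 0%N).

(** Only the values of [Y] at nonnegative times are relevant. *)
Record free_unitary_brownian_motion M (tau : (H -> H) -> R[i])
    (Y : R -> H -> H) : Prop := {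
  fubm_mem : forall t, 0 <= t -> M (Y t);
  fubm_unitary : forall t, 0 <= t -> unitary (Y t);
  fubm_start : Y 0 = idfun;
  fubm_free_increments : forall (n : nat) (t : nat -> R), 0 <= t 0%N ->
    (forall k, (k.+1 < n)%N -> t k < t k.+1) ->
    star_free tau (fun k : 'I_n => [set increment Y t k]);
  fubm_stationary : forall s t, 0 <= s -> s < t ->
    same_star_law tau (Y t \o adj (Y s)) (Y (t - s));
  fubm_moments : forall (t : R) (k : nat), 0 <= t -> (0 < k)%N ->
    let m := expR (- (k%:R * t) / 2) / k%:R * laguerre1 k.-1 (k%:R * t) in
    tau (iter k (Y t)) = m%:C /\ tau (iter k (adj (Y t))) = m%:C }.

Definition star_free_from (tau : (H -> H) -> R[i]) (Y : R -> H -> H) P :=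
  star_free tau (fun b : bool =>
    if b then [set Y t | t in [set t : R | 0 <= t]] else [set P]).

(** The maximum is taken in the partial order of [R[i]], between real
    numbers. *)
Definition general_position (tau : (H -> H) -> R[i]) P Q :=
  tau (meet_projection P Q) = Num.max (tau P + tau Q - 1) 0.

End WstarProbability.

(* Main.v *)
Require Import Defs.
From HB Require Import structures.
From mathcomp Require Import all_boot all_order all_algebra.
From mathcomp Require Import complex ring lra zify.
From mathcomp Require Import all_classical all_reals all_analysis.

Set Implicit Arguments.
Unset Strict Implicit.
Unset Printing Implicit Defensive.

Import Order.TTheory GRing.Theory Num.Theory.
Import numFieldNormedType.Exports.

Local Open Scope classical_set_scope.
Local Open Scope complex_scope.
Local Open Scope ring_scope.

Local Notation Re := complex.Re.
Local Notation Im := complex.Im.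

(** Put [Q_t = Y_t P Y_t^-1] and [m_n(t) = tau((P Q_t)^n)], with
    [m_0(t) = theta]. By von Neumann's alternating projections the powers
    [P (Q P)^n] decrease strongly to the meet of [P] and [Q], so, the state
    being normal, the theorem says that [m_n(t)] tends to
    [max(2 theta - 1, 0)] as [n] grows, for every [t > 0].

    The limit is at least this value for any two projections of trace [theta]:
    the moments are nonnegative, and passing from [P], [Q] to [1 - P], [1 - Q]
    shifts each of them by [1 - 2 theta] ([moment_complement]).

    The other bound comes from the evolution in time. For small [h > 0] the
    increment [Z = Y_(t+h) Y_t^-1] is star-free from [{Y_t, P}]
    ([increment_free]), and the first two moments of [Z] show that
    [Z - tau(Z)] has 2-norm of order [h^(1/2)]. Expanding
    [tau((P Z Q_t Z^-1)^n)] to second order in [Z - tau(Z)], with freeness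
    to evaluate the second-order terms and Cauchy-Schwarz for the remainder,
    yields [m_n' = - n c_n], where
    [c_n = (1 - 2 theta) m_n - T_(n-1) + T_n] and
    [T_n = sum_(k <= n) m_k m_(n-k)] ([moment_liberation_step]).

    Differentiating once more,
    [c_n' = - n c_n + 2 sum_(k < n) k c_k (m_(n-1-k) - m_(n-k))]. The moments
    are nonincreasing in [n] and [c_n(0) = theta (1 - theta)], so induction on
    [n] gives [c_n >= 0]: every moment is nonincreasing in time
    ([m_time_noninc]). Hence if [a > 0] is a lower bound of all the [m_n(t)],
    it is one of all the [m_n(s)] with [s <= t]. The sum of the [c_n]
    telescopes, and on [[0, t]] it follows that
    [c_1 + ... + c_N >= N a (a - (2 theta - 1)) - 2] as soon as
    [a > 2 theta - 1]. But that sum is minus the time derivative of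
    [sum_(n <= N) m_n / n], which lies between 0 and the harmonic sum, and the
    latter is not of order [N]. So [a <= 2 theta - 1] ([moment_limit_le]).

    Differentiation is used in a one-sided form with an explicit error of order
    [h^(3/2)] uniform in time ([fwd_deriv]), as the expansion provides it. *)

(** * Forward derivatives with a uniform error term *)

Section ForwardDerivative.
Variable R : realType.
Implicit Types (f g : R -> R) (T C K h s t : R).

(** The bounds on [f] and [g] make the relation stable under products. The
    steps stop at 1/4, the range in which the exponentials met below are
    estimated by quadratic polynomials. *)
Definition fwd_deriv T f g := exists C : R, forall t, 0 <= t <= T ->
  [/\ `|f t| <= C, `|g t| <= C &
      forall h, 0 <= h <= 4^-1 -> t + h <= T ->
        `|f (t + h) - f t - h * g t| <= C * (h * Num.sqrt h)].

Lemma step_error_bounds h : 0 <= h <= 4^-1 ->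
  0 <= h * Num.sqrt h /\ h ^+ 2 <= h * Num.sqrt h /\ h * Num.sqrt h <= h.
Proof.
move=> /andP[h0 h4]; have h1 : h <= 1 by lra.
 have s0 := sqrtr_ge0 h; have s2 := sqr_sqrtr h0.
have s1 : Num.sqrt h <= 1 by rewrite -sqrtr1 ler_sqrt.
have hs : h <= Num.sqrt h by rewrite -{1}s2 expr2 ler_piMr.
by rewrite mulr_ge0 // expr2 ler_wpM2l // ler_piMr.
Qed.

Lemma fwd_deriv_ext T f g f1 g1 : (forall t, 0 <= t <= T -> f t = f1 t) ->
  (forall t, 0 <= t <= T -> g t = g1 t) -> fwd_deriv T f g -> fwd_deriv T f1 g1.
Proof.
move=> ef eg [C H]; exists C => t tT; have [H1 H2 H3] := H t tT.
rewrite -ef // -eg //; split=> // h h01 thT; rewrite -ef ?H3 //.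
by move: tT h01 => /andP[? ?] /andP[? ?]; apply/andP; split; [exact: addr_ge0|].
Qed.

Lemma fwd_deriv_cst T c : fwd_deriv T (fun=> c) (fun=> 0).
Proof.
exists `|c| => t tT; split=> // [|h h01 _]; first by rewrite normr0.
have [q0 _] := step_error_bounds h01.
by rewrite subrr mulr0 subr0 normr0 mulr_ge0.
Qed.

Lemma fwd_deriv_id T : fwd_deriv T id (fun=> 1).
Proof.
exists (1 + T) => t /andP[t0 tT]; split=> [||h h01 _].
- by rewrite ger0_norm //; lra.
- by rewrite normr1; lra.
- have [q0 _] := step_error_bounds h01.
  have -> : t + h - t - h * 1 = 0 by ring.
  by rewrite normr0 mulr_ge0 //; lra.
Qed.

Lemma fwd_derivD T f f' g g' : fwd_deriv T f f' -> fwd_deriv T g g' ->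
  fwd_deriv T (fun t => f t + g t) (fun t => f' t + g' t).
Proof.
move=> [C HC] [D HD]; exists (C + D) => t tT.
have [f1 f2 f3] := HC t tT; have [g1 g2 g3] := HD t tT.
split; [by rewrite (le_trans (ler_normD _ _)) ?lerD..|move=> h h01 thT].
have -> : f (t + h) + g (t + h) - (f t + g t) - h * (f' t + g' t) =
  (f (t + h) - f t - h * f' t) + (g (t + h) - g t - h * g' t) by ring.
by rewrite (le_trans (ler_normD _ _)) // mulrDl lerD ?f3 ?g3.
Qed.

Lemma fwd_derivM T f f' g g' : fwd_deriv T f f' -> fwd_deriv T g g' ->
  fwd_deriv T (fun t => f t * g t) (fun t => f' t * g t + f t * g' t).
Proof.
move=> [C HC] [D HD]; exists (6 * (C * D)) => t tT.
have [f1 f2 f3] := HC t tT; have [g1 g2 g3] := HD t tT.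
have [C0 D0] : 0 <= C /\ 0 <= D by split; apply: le_trans (normr_ge0 _) _; eauto.
have CD0 : 0 <= C * D by exact: mulr_ge0.
have B u v : `|u| <= C -> `|v| <= D -> `|u * v| <= C * D.
  by move=> uC vD; rewrite normrM ler_pM.
split=> [||h h01 thT].
- by rewrite (le_trans (B _ _ f1 g1)) //; lra.
- rewrite (le_trans (ler_normD _ _)) // (le_trans (lerD (B _ _ f2 g1) (B _ _ f1 g2))) //; lra.
have -> : f (t + h) * g (t + h) - f t * g t - h * (f' t * g t + f t * g' t) =
  (f (t + h) - f t) * (g (t + h) - g t) + f t * (g (t + h) - g t - h * g' t)
  + g t * (f (t + h) - f t - h * f' t) by ring.
have [q0 [q1 q2]] := step_error_bounds h01; set q := h * _ in q0 q1 q2 f3 g3 *.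
have h0 : 0 <= h by case/andP: h01.
have L u u' E : 0 <= E -> `|u'| <= E -> `|u - h * u'| <= E * q -> `|u| <= 2 * E * h.
  move=> E0 u'E uE; have -> : u = (u - h * u') + h * u' by ring.
  rewrite (le_trans (ler_normD _ _)) // normrM (ger0_norm h0).
  by rewrite (le_trans (lerD uE (lexx _))) //; nra.
have Lf := L _ _ _ C0 f2 (f3 h h01 thT); have Lg := L _ _ _ D0 g2 (g3 h h01 thT).
have P1 : `|(f (t + h) - f t) * (g (t + h) - g t)| <= 4 * (C * D) * q.
  rewrite normrM (le_trans (ler_pM _ _ Lf Lg)) //.
  have -> : 2 * C * h * (2 * D * h) = 4 * (C * D) * h ^+ 2 by ring.
  by rewrite ler_wpM2l //; lra.
have P2 : `|f t * (g (t + h) - g t - h * g' t)| <= C * D * q.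
  by rewrite normrM -mulrA ler_pM // g3.
have P3 : `|g t * (f (t + h) - f t - h * f' t)| <= C * D * q.
  by rewrite normrM (mulrC C) -mulrA ler_pM // f3.
have := ler_normD ((f (t + h) - f t) * (g (t + h) - g t) +
  f t * (g (t + h) - g t - h * g' t)) (g t * (f (t + h) - f t - h * f' t)).
have := ler_normD ((f (t + h) - f t) * (g (t + h) - g t))
  (f t * (g (t + h) - g t - h * g' t)).
lra.
Qed.

Lemma fwd_derivZ T c f g : fwd_deriv T f g ->
  fwd_deriv T (fun t => c * f t) (fun t => c * g t).
Proof.
move=> H; apply: fwd_deriv_ext (fwd_derivM (fwd_deriv_cst T c) H) => // t _ /=.
by rewrite mul0r add0r.
Qed.

Lemma fwd_deriv_sum T n (F G : 'I_n -> R -> R) :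
  (forall k, fwd_deriv T (F k) (G k)) ->
  fwd_deriv T (fun t => \sum_k F k t) (fun t => \sum_k G k t).
Proof.
elim: n F G => [|n IH] F G H.
  by apply: fwd_deriv_ext (fwd_deriv_cst T 0) => t _; rewrite big_ord0.
apply: fwd_deriv_ext (fwd_derivD (IH _ _ (fun k => H (widen_ord (leqnSn n) k))) (H ord_max)) => t _;
  by rewrite big_ord_recr.
Qed.

Lemma fwd_deriv_shift T s f g : 0 <= s -> fwd_deriv T f g ->
  fwd_deriv (T - s) (fun u => f (s + u)) (fun u => g (s + u)).
Proof.
move=> s0 [C H]; exists C => t /andP[t0 tT].
have [|H1 H2 H3] := H (s + t); first by apply/andP; split; lra.
split=> // h h01 thT; rewrite addrA; apply: H3 => //; lra.
Qed.

(** Gronwall's lemma. When [[0, T]] is cut into [k] steps, the errors add up to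
    at most [k C (T / k)^(3/2)], which vanishes as [k] grows. *)
Lemma fwd_deriv_ge0 T f g K : fwd_deriv T f g -> 0 <= K -> 0 <= T ->
  (forall t, 0 <= t <= T -> - (K * f t) <= g t) -> 0 <= f 0 -> 0 <= f T.
Proof.
move=> [C H] K0 T0 gK f0; rewrite leNgt; apply/negP => fT.
have C0 : 0 <= C.
  by have [|H1 _ _] := H 0; rewrite ?lexx //; apply: le_trans (normr_ge0 _) H1.
pose d := - f T; have d0 : 0 < d by rewrite /d oppr_gt0.
(* [k > B] makes the step at most 1/4, keeps [1 - K h] nonnegative and brings
   the accumulated error [C T (T / k)^(1/2)] below [d]. *)
pose B := T * (C * T / d) ^+ 2 + K * T + 4 * T + 1.
have Q0 := sqr_ge0 (C * T / d); have TQ := mulr_ge0 T0 Q0; have KT := mulr_ge0 K0 T0.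
have [k kB] : exists k : nat, B < k%:R.
  exists (Num.bound B); rewrite archi_boundP // /B; lra.
have k0 : 0 < k%:R :> R by apply: le_lt_trans kB; rewrite /B; lra.
pose h := T / k%:R.
have hk : h * k%:R = T by rewrite /h divfK // gt_eqF.
have h0 : 0 <= h by rewrite divr_ge0 // ltW.
have h1 : h <= 4^-1.
  by rewrite /h ler_pdivrMr // mulrC ler_pdivlMr // mulrC (le_trans _ (ltW kB)) // /B; lra.
have Kh : K * h <= 1.
  by rewrite /h mulrA ler_pdivrMr // mul1r (le_trans _ (ltW kB)) // /B; lra.
have [q0 _] : 0 <= h * Num.sqrt h /\ True by split=> //; rewrite mulr_ge0 ?sqrtr_ge0.
set q := h * Num.sqrt h in q0 H.
have step j : (j <= k)%N -> - (j%:R * C * q) <= f (j%:R * h).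
  elim: j => [_|j IH jk]; first by rewrite !mul0r oppr0.
  have {}IH := IH (ltnW jk).
  have jh : j%:R * h + h <= T.
    by rewrite -hk mulrC -{2}(mulr1 h) -mulrDr ler_wpM2l // natr1 ler_nat.
  have jT : 0 <= j%:R * h <= T by apply/andP; split; [rewrite mulr_ge0|lra].
  have [_ _ H3] := H _ jT.
  have {}H3 := H3 h; rewrite h0 h1 in H3; have {}H3 := H3 isT jh.
  have gj := gK _ jT.
  rewrite -natr1 [X in f X]mulrDl mul1r; move: H3; rewrite ler_norml -/q => /andP[H3 _].
  have j0 : 0 <= j%:R :> R by [].
  have A : h * g (j%:R * h) >= h * - (K * f (j%:R * h)) by rewrite ler_wpM2l.
  have A2 : (1 - K * h) * f (j%:R * h) >= (1 - K * h) * - (j%:R * C * q).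
    by rewrite ler_wpM2l //; lra.
  have A3 : 0 <= (K * h) * (j%:R * C * q) by rewrite !mulr_ge0.
  lra.
have := step k (leqnn k); rewrite (mulrC _ h) hk => Hk.
have E : k%:R * C * q = C * T * Num.sqrt h by rewrite /q -hk; ring.
rewrite E in Hk.
have dle : d <= C * T * Num.sqrt h by rewrite /d; lra.
have : d ^+ 2 <= (C * T) ^+ 2 * h.
  by rewrite -[h in X in _ <= X](sqr_sqrtr h0) -exprMn ler_sqr // ?nnegrE ?mulr_ge0 ?sqrtr_ge0 // ltW.
have -> : (C * T) ^+ 2 * h = d ^+ 2 * (T * (C * T / d) ^+ 2 / k%:R).
  rewrite /h; field; apply/andP; split; apply: lt0r_neq0 => //.
rewrite -{1}(mulr1 (d ^+ 2)) ler_pM2l ?exprn_gt0 // ler_pdivlMr // mul1r leNgt => /negP; apply.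
by apply: le_lt_trans kB; rewrite /B; lra.
Qed.

Lemma fwd_deriv_le T f g K : fwd_deriv T f g -> 0 <= T ->
  (forall t, 0 <= t <= T -> g t <= - K) -> f T <= f 0 - K * T.
Proof.
move=> fg T0 gK.
have D : fwd_deriv T (fun u => f 0 + (- 1 * f u + (- K) * u)) (fun u => 0 + (- 1 * g u + (- K) * 1)).
  apply: fwd_derivD; first exact: fwd_deriv_cst.
  by apply: fwd_derivD; apply: fwd_derivZ => //; apply: fwd_deriv_id.
have := fwd_deriv_ge0 D (lexx 0) T0; rewrite /= => H.
have : 0 <= f 0 + (-1 * f T + - K * T); last by lra.
apply: H => [t tT|]; last by lra.
by rewrite mul0r; have := gK t tT; lra.
Qed.

Lemma fwd_deriv_noninc T f g s : fwd_deriv T f g -> 0 <= s <= T ->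
  (forall t, 0 <= t <= T -> g t <= 0) -> f T <= f s.
Proof.
move=> fg /andP[s0 sT] g0.
have := @fwd_deriv_le _ _ _ 0 (fwd_deriv_shift s0 fg).
rewrite mul0r subr0 addr0 (_ : s + (T - s) = T); last by ring.
apply; first by lra.
by move=> t /andP[t0 tT]; rewrite oppr0; apply: g0; apply/andP; split; lra.
Qed.

End ForwardDerivative.

(** * The flow of the moments *)

Section MomentFlow.
Variables (R : realType) (theta : R) (m : nat -> R -> R).

Definition mconv n t := \sum_(k < n.+1) m k t * m (n - k)%N t.

(** The rate [c_n] in [m_n' = - n c_n]. The extreme terms of [mconv n] amount to
    [2 theta m_n], so the expression only involves products of moments of order
    between 1 and [n - 1] besides [m_n] and [mconv (n - 1)]; written in this way
    the rates telescope. *)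
Definition decay n t :=
  if n is k.+1 then (1 - theta *+ 2) * m n t - mconv k t + mconv n t else 0.

Hypothesis theta_le1 : theta <= 1.
Hypothesis m0 : forall t : R, 0 <= t -> m 0 t = theta.
Hypothesis m_start : forall n, m n 0 = theta.
Hypothesis m_ge0 : forall n (t : R), 0 <= t -> 0 <= m n t.
Hypothesis m_noninc : forall n (t : R), 0 <= t -> m n.+1 t <= m n t.
Hypothesis m_flow : forall n T, fwd_deriv T (m n) (fun t => - (n%:R * decay n t)).

Lemma mconv_flow n T : fwd_deriv T (mconv n)
  (fun t => - (\sum_(k < n.+1) k%:R * decay k t * m (n - k)%N t) *+ 2).
Proof.
have := @fwd_deriv_sum _ T n.+1 _ _ (fun k => fwd_derivM (m_flow k T) (m_flow (n - k)%N T)).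
apply: fwd_deriv_ext => // t _.
rewrite big_split /= mulr2n -sumrN; congr (_ + _); first by apply: eq_bigr => k _; ring.
rewrite [RHS](reindex_inj rev_ord_inj) /=; apply: eq_bigr => k _.
by rewrite subSS subKn ?leq_ord //; ring.
Qed.

(** The contribution [2 theta n c_n] of [(1 - 2 theta) m_n] cancels against the
    term of [mconv n] that contains [m_0 m_n]. *)
Lemma decay_flow n T : fwd_deriv T (decay n.+1)
  (fun t => - (n.+1%:R * decay n.+1 t) +
     (\sum_(k < n.+1) k%:R * decay k t * (m (n - k)%N t - m (n.+1 - k)%N t)) *+ 2).
Proof.
have := fwd_derivD (fwd_derivD (fwd_derivZ (1 - theta *+ 2) (m_flow n.+1 T))
  (fwd_derivZ (-1) (mconv_flow n T))) (mconv_flow n.+1 T).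
apply: fwd_deriv_ext => [t _|t /andP[t0 _]] /=; first by rewrite mulN1r.
rewrite [in X in _ + X = _]big_ord_recr /= subnn m0 //.
set s := \sum_(k < n.+1) _ * m (n - k)%N t.
set s1 := \sum_(k < n.+1) _ * m (n.+1 - k)%N t.
have -> : \sum_(k < n.+1) k%:R * decay k t * (m (n - k)%N t - m (n.+1 - k)%N t) = s - s1.
  by rewrite /s /s1 -sumrB; apply: eq_bigr => k _; rewrite mulrBr.
by rewrite /=; ring.
Qed.

(** The moments are nonincreasing in their order, so in [decay_flow] the rates
    of lower order enter with nonnegative coefficients, and Gronwall's lemma
    applies by induction. *)
Lemma decay_ge0 n (t : R) : 0 <= t -> 0 <= decay n t.
Proof.
elim/ltn_ind: n t => -[//|n] IH t t0.
have th0 : 0 <= theta by rewrite -(m_start 0) m_ge0.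
apply: (fwd_deriv_ge0 (K := n.+1%:R) (decay_flow n t)) => //.
  move=> s /andP[s0 _]; rewrite lerDl mulrn_wge0 //; apply: sumr_ge0 => k _.
  rewrite !mulr_ge0 // ?IH // subr_ge0 subSn ?m_noninc //.
  by rewrite -ltnS.
rewrite /decay /mconv m_start.
rewrite (eq_bigr (fun=> theta * theta)); last by move=> k _; rewrite !m_start.
rewrite [X in _ + X](eq_bigr (fun=> theta * theta)); last by move=> k _; rewrite !m_start.
rewrite !sumr_const !card_ord (mulrSr (theta * theta) n.+1).
set w := _ *+ n.+1.
have -> : (1 - theta *+ 2) * theta - w + (w + theta * theta) = theta * (1 - theta) by ring.
by rewrite mulr_ge0 // subr_ge0.
Qed.

Lemma m_time_noninc n (s t : R) : 0 <= s <= t -> m n t <= m n s.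
Proof.
move=> st; apply: fwd_deriv_noninc (m_flow n t) st _ => u /andP[u0 _].
by rewrite oppr_le0 mulr_ge0 // decay_ge0.
Qed.

Lemma sum_decay N (t : R) : 0 <= t ->
  \sum_(n < N) decay n.+1 t =
  (1 - theta *+ 2) * (\sum_(n < N) m n.+1 t) + mconv N t - theta ^+ 2.
Proof.
move=> t0; elim: N => [|N IH].
  by rewrite !big_ord0 /mconv big_ord1 m0 //; ring.
by rewrite !big_ord_recr /= IH; ring.
Qed.

(** Sum the inequalities [(m_k - a) (m_(N-k) - a) >= 0]. *)
Lemma mconv_ge a N (t : R) : 0 <= t -> (forall n, a <= m n t) ->
  a * (\sum_(n < N.+1) m n t) *+ 2 - N.+1%:R * a ^+ 2 <= mconv N t.
Proof.
move=> t0 am.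
have -> : a * (\sum_(n < N.+1) m n t) *+ 2 - N.+1%:R * a ^+ 2 =
  \sum_(k < N.+1) (a * m k t + a * m (N - k)%N t - a ^+ 2).
  have rev : \sum_(k < N.+1) m (N - k)%N t = \sum_(k < N.+1) m k t.
    by rewrite [RHS](reindex_inj rev_ord_inj) /=; apply: eq_bigr => k _; rewrite subSS.
  rewrite sumrB sumr_const card_ord big_split /= -!mulr_sumr rev mulr_natl.
  by rewrite mulr2n.
apply: ler_sum => k _; rewrite -subr_ge0.
have -> : m k t * m (N - k)%N t - (a * m k t + a * m (N - k)%N t - a ^+ 2) =
  (m k t - a) * (m (N - k)%N t - a) by ring.
by rewrite mulr_ge0 // subr_ge0.
Qed.

(** The harmonic sum is sublinear: the terms of rank at most [M] are at most 1,
    the others at most [1 / (M + 1)]. *)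
Lemma harmonic_sum_le (N M : nat) :
  \sum_(n < N) n.+1%:R^-1 <= M%:R + N%:R / M.+1%:R :> R.
Proof.
have : \sum_(n < N) n.+1%:R^-1 <= (minn N M)%:R + N%:R / M.+1%:R :> R.
  elim: N => [|N IH]; first by rewrite big_ord0 min0n mul0r addr0.
  rewrite big_ord_recr /= [N.+1%:R / _](_ : _ = N%:R / M.+1%:R + M.+1%:R^-1); last first.
    by rewrite -[N.+1%:R](natr1 N) mulrDl mul1r.
  have [NM|MN] := ltnP N M.
    rewrite (minn_idPl NM); move: IH; rewrite (minn_idPl (ltnW NM)) => IH.
    have N1 : N.+1%:R^-1 <= 1 :> R by rewrite invf_le1 ?ltr0n // ler1n.
    have M0 : 0 <= M.+1%:R^-1 :> R by rewrite invr_ge0.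
    rewrite -[X in _ <= X + _](natr1 N); move: IH N1 M0.
    move: (M.+1%:R^-1) (N%:R / _) (N.+1%:R^-1) (\sum_(_ < _) _) => *; lra.
  rewrite (minn_idPr (leqW MN)); move: IH; rewrite (minn_idPr MN) => IH.
  have : N.+1%:R^-1 <= M.+1%:R^-1 :> R by rewrite lef_pV2 ?posrE ?ltr0n // ler_nat ltnS.
  move: IH; move: (M.+1%:R^-1) (N%:R / _) (N.+1%:R^-1) (\sum_(_ < _) _) => *; lra.
by move=> /le_trans; apply; rewrite lerD2r ler_nat geq_minr.
Qed.

(** The sum [sum_(n <= N) m_n / n] starts below the harmonic sum, stays
    nonnegative, and would decrease at a rate at least [N kappa - 2], with
    [kappa = a (a - (2 theta - 1))], were [kappa] positive. *)
Theorem moment_limit_le (t a : R) : 0 < t -> 0 < a -> (forall n, a <= m n t) ->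
  a <= theta *+ 2 - 1.
Proof.
move=> t0 a0 am; rewrite leNgt; apply/negP => ath.
have th0 : 0 <= theta by rewrite -(m_start 0) m_ge0.
have ath' : a <= theta by rewrite -(m0 (ltW t0)) am.
pose kappa := a * (1 - theta *+ 2 + a).
have kappa0 : 0 < kappa by rewrite mulr_gt0 //; lra.
have lb N s : 0 <= s <= t -> N%:R * kappa - 2 <= \sum_(n < N) decay n.+1 s.
  move=> st; have s0 : 0 <= s by case/andP: st.
  have ams n : a <= m n s by apply: le_trans (am n) (m_time_noninc n st).
  rewrite sum_decay //; have := mconv_ge N s0 ams.
  rewrite big_ord_recl m0 //=; under eq_bigr do rewrite /bump /= add1n.
  set S := \sum_(_ < _) _.
  have SN : N%:R * a <= S.
    rewrite mulr_natl -[N in X in X <= _]card_ord -sumr_const.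
    exact: ler_sum.
  have A2 : 0 <= (1 - theta *+ 2 + a *+ 2) * (S - N%:R * a).
    by rewrite mulr_ge0 // ?subr_ge0 //; lra.
  rewrite -natr1 /kappa => H.
  have a2 : a ^+ 2 <= 1 by rewrite expr_le1 ?(le_trans ath') // ltW.
  have t2 : theta ^+ 2 <= 1 by rewrite expr_le1.
  have ta : 0 <= a * theta by rewrite mulr_ge0 // ltW.
  lra.
have key N : (N%:R * kappa - 2) * t <= \sum_(n < N) n.+1%:R^-1.
  have D : fwd_deriv t (fun s => \sum_(n < N) n.+1%:R^-1 * m n.+1 s)
      (fun s => \sum_(n < N) n.+1%:R^-1 * - (n.+1%:R * decay n.+1 s)).
    by apply: fwd_deriv_sum => n; apply: fwd_derivZ.
  have := fwd_deriv_le (K := N%:R * kappa - 2) D (ltW t0).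
  have S1 : \sum_(n < N) n.+1%:R^-1 * m n.+1 0 <= \sum_(n < N) n.+1%:R^-1.
    by apply: ler_sum => n _; rewrite m_start ler_piMr.
  have S2 : 0 <= \sum_(n < N) n.+1%:R^-1 * m n.+1 t.
    by apply: sumr_ge0 => n _; rewrite mulr_ge0 // m_ge0 // ltW.
  move=> H; have : \sum_(n < N) n.+1%:R^-1 * m n.+1 t <=
     \sum_(n < N) n.+1%:R^-1 * m n.+1 0 - (N%:R * kappa - 2) * t; last by lra.
  apply: H => s st; under eq_bigr do rewrite mulrN mulrA mulVf ?pnatr_eq0 // mul1r.
  by rewrite sumrN lerN2 lb.
(* [M] makes the linear part of [harmonic_sum_le] at most half of [N kappa t];
   [N] then beats the constants [M] and [2 t]. *)
pose e := kappa * t; have e0 : 0 < e by rewrite mulr_gt0.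
pose M := Num.bound (2 / e); have := archi_boundP (ltW (divr_gt0 (ltr0Sn R 1) e0)).
rewrite -/M => HM.
pose B := 2 * (M%:R + 2 * t) / e.
have B0 : 0 <= B.
  by rewrite divr_ge0 ?(ltW e0) // mulr_ge0 // addr_ge0 // mulr_ge0 // ltW.
have := archi_boundP B0; set N := Num.bound B => HN.
have := le_trans (key N) (harmonic_sum_le N M); apply/negP; rewrite -ltNge.
have MN : N%:R / M.+1%:R <= N%:R * (e / 2) :> R.
  rewrite ler_wpM2l // -[e / 2]invrK lef_pV2 ?posrE ?ltr0n // ?invr_gt0 ?divr_gt0 //.
  rewrite invf_div (le_trans (ltW HM)) // ler_nat //.
have : B * (e / 2) < N%:R * (e / 2) by rewrite ltr_pM2r // divr_gt0.
have -> : B * (e / 2) = M%:R + 2 * t by rewrite /B; field; apply: lt0r_neq0.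
have -> : (N%:R * kappa - 2) * t = N%:R * e - 2 * t by rewrite /e; ring.
by move: MN; move: (N%:R / M.+1%:R) => *; lra.
Qed.

End MomentFlow.

(** * Tracial star-algebras *)

Section ComplexRe.
Variable R : realType.
Implicit Types z w : R[i].

Lemma ReD z w : Re (z + w) = Re z + Re w. Proof. by case: z; case: w. Qed.
Lemma ReN z : Re (- z) = - Re z. Proof. by case: z. Qed.
Lemma ReB z w : Re (z - w) = Re z - Re w. Proof. by rewrite ReD ReN. Qed.
Lemma ReZ (c : R) z : Re (c%:C * z) = c * Re z.
Proof. by case: z => a b /=; rewrite mul0r subr0. Qed.
Lemma ge0_complex z : 0 <= z -> z = (Re z)%:C.
Proof. by case: z => a b; rewrite lecE /= => /andP[/eqP-> _]. Qed.
Lemma ge0_Re z : 0 <= z -> 0 <= Re z.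
Proof. by case: z => a b; rewrite lecE /= => /andP[_]. Qed.
Lemma Re_sum I (r : seq I) (Q : pred I) (G : I -> R[i]) :
  Re (\sum_(i <- r | Q i) G i) = \sum_(i <- r | Q i) Re (G i).
Proof. by apply: (big_morph (@complex.Re R) ReD). Qed.
Lemma real_complex_max (a b : R) : (Num.max a b)%:C = Num.max a%:C b%:C.
Proof. by rewrite /Order.max ltcR; case: ifP. Qed.
End ComplexRe.

Lemma nonneg_quadratic_discriminant (R : realFieldType) (a b c : R) :
  0 <= a -> 0 <= c -> (forall s, 0 <= a + s * b *+ 2 + s ^+ 2 * c) -> b ^+ 2 <= a * c.
Proof.
move=> a0 c0 K; have [cE|cN] := eqVneq c 0.
  rewrite cE mulr0; have [->|b0] := eqVneq b 0; first by rewrite expr0n.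
  by have := K (- (a + 1) / b); rewrite cE mulr0 addr0 divfK //; lra.
have c1 : 0 < c by rewrite lt_def cN.
have := K (- b / c); have -> : a + - b / c * b *+ 2 + (- b / c) ^+ 2 * c = a - b ^+ 2 / c.
  by field.
by rewrite subr_ge0 ler_pdivrMr.
Qed.

(** The algebraic part of the argument only sees an algebra with an involution
    and a positive trace. *)
Record tracial_star_algebra (R : realType) (A : algType R[i]) (star : A -> A)
    (tr : A -> R[i]) : Prop := {
  star_lin : forall (c : R[i]) x y, star (c *: x + y) = (c^*)%C *: star x + star y;
  starK : involutive star;
  starM : forall x y, star (x * y) = star y * star x;
  tr_lin : forall (c : R[i]) x y, tr (c *: x + y) = c * tr x + tr y;
  trC : forall x y, tr (x * y) = tr (y * x);
  tr_ge0 : forall x, 0 <= tr (star x * x);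
  tr1 : tr 1 = 1 }.

Section Tracial.
Variables (R : realType) (A : algType R[i]) (star : A -> A) (tr : A -> R[i]).
Hypothesis SA : tracial_star_algebra star tr.
Implicit Types (x y a b : A) (c : R[i]).

Lemma trD x y : tr (x + y) = tr x + tr y.
Proof. by rewrite -[x]scale1r (tr_lin SA) mul1r scale1r. Qed.
Lemma tr0 : tr 0 = 0.
Proof. by have := trD 0 0; rewrite addr0 => /eqP; rewrite -subr_eq0 opprD addrA subrr sub0r oppr_eq0 => /eqP. Qed.
Lemma trZ c x : tr (c *: x) = c * tr x.
Proof. by rewrite -[c *: x]addr0 (tr_lin SA) tr0 addr0. Qed.
Lemma trN x : tr (- x) = - tr x.
Proof. by rewrite -scaleN1r trZ mulN1r. Qed.
Lemma trB x y : tr (x - y) = tr x - tr y. Proof. by rewrite trD trN. Qed.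
Lemma tr_sum I (r : seq I) (Q : pred I) (G : I -> A) :
  tr (\sum_(i <- r | Q i) G i) = \sum_(i <- r | Q i) tr (G i).
Proof. exact: (big_morph tr trD tr0). Qed.

Lemma starD x y : star (x + y) = star x + star y.
Proof. by rewrite -[x]scale1r (star_lin SA) conjc1 !scale1r. Qed.
Lemma star0 : star 0 = 0.
Proof. by have := starD 0 0; rewrite addr0 => /eqP; rewrite -subr_eq0 opprD addrA subrr sub0r oppr_eq0 => /eqP. Qed.
Lemma starZ c x : star (c *: x) = (c^*)%C *: star x.
Proof. by rewrite -[c *: x]addr0 (star_lin SA) star0 addr0. Qed.
Lemma starN x : star (- x) = - star x.
Proof. by rewrite -scaleN1r starZ rmorphN rmorph1 scaleN1r. Qed.
Lemma starB x y : star (x - y) = star x - star y. Proof. by rewrite starD starN. Qed.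
Lemma star1 : star 1 = 1.
Proof. by rewrite -[RHS](starK SA) -[star 1 in RHS]mulr1 (starM SA) (starK SA) mulr1. Qed.

(** The squared 2-norm of the trace, and below the 2-norm itself. *)
Definition sqn x : R := Re (tr (star x * x)).
Definition nrm x : R := Num.sqrt (sqn x).

Lemma sqnE x : sqn x = Re (tr (star x * x)). Proof. by []. Qed.
Lemma sqn_ge0 x : 0 <= sqn x. Proof. exact/ge0_Re/(tr_ge0 SA). Qed.
Lemma nrm_ge0 x : 0 <= nrm x. Proof. exact: sqrtr_ge0. Qed.
Lemma sqr_nrm x : nrm x ^+ 2 = sqn x. Proof. by rewrite sqr_sqrtr ?sqn_ge0. Qed.
Lemma ler_nrm x y : (nrm x <= nrm y) = (sqn x <= sqn y).
Proof. by rewrite ler_sqrt ?sqn_ge0. Qed.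

Lemma sqnD x y : sqn (x + y) = sqn x + sqn y + Re (tr (star x * y) + tr (star y * x)).
Proof.
by rewrite /sqn starD mulrDl !mulrDr !trD !ReD; lra.
Qed.

(** Polarization: positivity on [x + i y] forces the two mixed terms to have the
    same real part. *)
Lemma Re_tr_sym x y : Re (tr (star x * y)) = Re (tr (star y * x)).
Proof.
have H z : Im (tr (star z * z)) = 0 by apply: ger0_Im (tr_ge0 SA z).
have := H (x + 'i *: y); rewrite starD mulrDl !mulrDr !trD starZ.
rewrite -!scalerAl -!scalerAr !trZ.
move: (H x) (H y); case: (tr (star x * x)) (tr (star y * y)) (tr (star x * y)) (tr (star y * x))
  => [a a'] [b b'] [c c'] [d d'] /= -> ->.
by rewrite !(mul0r, mul1r, add0r, mulr0, oppr0, addr0, subr0, sub0r, mulN1r, mulr1, opprK) /= => /eqP; rewrite ?subr_eq0 => /eqP.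
Qed.

Lemma sqn_star x : sqn (star x) = sqn x.
Proof. by rewrite /sqn (starK SA) (trC SA). Qed.
Lemma nrm_star x : nrm (star x) = nrm x.
Proof. by rewrite /nrm sqn_star. Qed.

Lemma sqnZ (c : R) x : sqn (c%:C *: x) = c ^+ 2 * sqn x.
Proof. by rewrite /sqn starZ -scalerAl -scalerAr !trZ conjc_real !ReZ mulrA expr2. Qed.

Lemma nrmZ (c : R) x : nrm (c%:C *: x) = `|c| * nrm x.
Proof. by rewrite /nrm sqnZ sqrtrM ?sqr_ge0 // sqrtr_sqr. Qed.

Lemma Re_cauchy_schwarz x y : `|Re (tr (star x * y))| <= nrm x * nrm y.
Proof.
rewrite -ler_sqr ?nnegrE ?mulr_ge0 ?nrm_ge0 // exprMn !sqr_nrm real_normK ?num_real //.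
apply: nonneg_quadratic_discriminant; rewrite ?sqn_ge0 // => s.
have := sqn_ge0 (x + s%:C *: y); rewrite sqnD sqnZ -scalerAr starZ conjc_real -(scalerAl s%:C (star y)).
by rewrite !trZ ReD !ReZ -(Re_tr_sym x y); lra.
Qed.

Lemma nrmD x y : nrm (x + y) <= nrm x + nrm y.
Proof.
rewrite -ler_sqr ?nnegrE ?addr_ge0 ?nrm_ge0 // sqr_nrm sqnD ReD -(Re_tr_sym x y) sqrrD !sqr_nrm.
have := le_trans (ler_norm _) (Re_cauchy_schwarz x y); lra.
Qed.

Lemma nrm0 : nrm 0 = 0.
Proof. by rewrite /nrm /sqn mulr0 tr0 sqrtr0. Qed.

Lemma nrm_sum_le n (G : 'I_n -> A) K : (forall k, nrm (G k) <= K) ->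
  nrm (\sum_k G k) <= n%:R * K.
Proof.
move=> GK; rewrite -[n in n%:R]card_ord mulr_natl -sumr_const.
elim/big_ind2: _ => [|x u y v xu yv|k _]; rewrite ?nrm0 ?GK //.
by rewrite (le_trans (nrmD _ _)) ?lerD.
Qed.

(** An operator-norm bound expressed through the trace alone. Both one-sided
    multiplications are bounded, since factors are removed on either side of a
    product. *)
Definition bounded_mul K a := forall x, nrm (a * x) <= K * nrm x /\ nrm (x * a) <= K * nrm x.
Local Notation contraction := (bounded_mul 1).

Lemma bounded_mulM K L a b : 0 <= K -> 0 <= L ->
  bounded_mul K a -> bounded_mul L b -> bounded_mul (K * L) (a * b).
Proof.
move=> K0 L0 Ka Lb x; split.
  by rewrite -mulrA (le_trans (Ka _).1) // -mulrA ler_wpM2l ?(Lb _).1.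
by rewrite mulrA (le_trans (Lb _).2) // (mulrC K) -mulrA ler_wpM2l ?(Ka _).2.
Qed.

Lemma contraction1 : contraction 1.
Proof. by move=> x; rewrite mulr1 !mul1r. Qed.

Lemma contractionM a b : contraction a -> contraction b -> contraction (a * b).
Proof. by move=> ha hb; have := bounded_mulM ler01 ler01 ha hb; rewrite mulr1. Qed.

Definition is_projection p := star p = p /\ p * p = p.

Lemma projectionC p : is_projection p -> is_projection (1 - p).
Proof.
by move=> [s i]; split; rewrite ?starB ?star1 ?s // mulrBl mul1r mulrBr mulr1 i subrr subr0.
Qed.

Lemma sqn_projection p x : is_projection p -> sqn (p * x) = Re (tr (star x * p * x)).
Proof. by move=> [s i]; rewrite /sqn (starM SA) s !mulrA -(mulrA _ p p) i. Qed.

Lemma sqn_pythagoras p x : is_projection p -> sqn x = sqn (p * x) + sqn ((1 - p) * x).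
Proof.
move=> pp; rewrite (sqn_projection x pp) (sqn_projection x (projectionC pp)).
by rewrite mulrBr mulr1 mulrBl trB ReB /sqn; lra.
Qed.

Lemma contraction_of_left a : (forall x, sqn (a * x) <= sqn x) ->
  (forall x, sqn (star a * x) <= sqn x) -> contraction a.
Proof.
move=> l r x; rewrite !mul1r !ler_nrm l; split=> //.
by rewrite -sqn_star -(sqn_star x) (starM SA) r.
Qed.

Lemma contraction_projection p : is_projection p -> contraction p.
Proof.
move=> pp; have H x : sqn (p * x) <= sqn x by rewrite [leRHS](sqn_pythagoras x pp) lerDl sqn_ge0.
by apply: contraction_of_left => //; case: pp => ->.
Qed.

Lemma contraction_unitary u : star u * u = 1 -> u * star u = 1 -> contraction u.
Proof.
move=> u1 u2; apply: contraction_of_left => x; rewrite /sqn (starM SA) ?(starK SA) mulrA.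
  by rewrite -(mulrA _ (star u) u) u1 mulr1.
by rewrite -(mulrA _ u (star u)) u2 mulr1.
Qed.

Lemma bounded_mulZ (c K : R) a : 0 <= c -> bounded_mul K a -> bounded_mul (c * K) (c%:C *: a).
Proof.
move=> c0 Ka x; rewrite -scalerAl -scalerAr !nrmZ (ger0_norm c0) -mulrA.
by rewrite !ler_wpM2l //; have := Ka x; case.
Qed.

(** By traciality the squared 2-norm is the inner product of [a v v^*] and
    [u^* u a]; Cauchy-Schwarz then removes the middle factor. For two increments
    this leaves the 2-norms of [u^* u] and [v v^*], which are of order [h]. *)
Lemma nrm_sandwich u a v K : contraction a -> nrm (star u * u) <= K ->
  nrm (v * star v) <= K -> nrm (u * a * v) <= K.
Proof.
move=> ca uK vK; have K0 : 0 <= K := le_trans (nrm_ge0 _) uK.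
rewrite -ler_sqr ?nnegrE ?nrm_ge0 // sqr_nrm /sqn.
have -> : tr (star (u * a * v) * (u * a * v)) =
    tr (star (a * (v * star v)) * (star u * u * a)).
  rewrite !(starM SA) (starK SA) !mulrA (trC SA) !mulrA; done.
apply: le_trans (le_trans (ler_norm _) (Re_cauchy_schwarz _ _)) _.
rewrite expr2 ler_pM ?nrm_ge0 //.
  by rewrite (le_trans (ca _).1) // mul1r.
by rewrite (le_trans (ca _).2) // mul1r.
Qed.

End Tracial.

(** * Freeness of subalgebras *)

Section Freeness.
Variables (R : realType) (A : algType R[i]) (star : A -> A) (tr : A -> R[i]).
Hypothesis SA : tracial_star_algebra star tr.
Implicit Types (x y a b : A) (c : R[i]).

Definition first_label (I : Type) (l : seq (I * A)) := ohead (unzip1 l).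

Definition word (I : Type) (l : seq (I * A)) : A := \prod_(x <- l) x.2.

Fixpoint alternating (I : eqType) (B : I -> A -> Prop) (l : seq (I * A)) : Prop :=
  if l is x :: l' then
    [/\ B x.1 x.2, tr x.2 = 0, first_label l' != Some x.1 & alternating B l']
  else True.

Definition free_family (I : eqType) (B : I -> A -> Prop) :=
  forall l, l != [::] -> alternating B l -> tr (word l) = 0.

Record subalgebra (B : A -> Prop) : Prop := {
  subalg1 : B 1;
  subalg_lin : forall c x y, B x -> B y -> B (c *: x + y);
  subalgM : forall x y, B x -> B y -> B (x * y) }.

Definition centered a := a - (tr a)%:A.

Lemma tr_centered a : tr (centered a) = 0.
Proof. by rewrite (trB SA) (trZ SA) (tr1 SA) mulr1 subrr. Qed.

Lemma centeredK a : a = tr a *: 1 + centered a.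
Proof. by rewrite addrC subrK. Qed.

Lemma subalg_centered B a : subalgebra B -> B a -> B (centered a).
Proof.
by move=> SB Ba; rewrite /centered addrC -scaleNr; apply: subalg_lin (subalg1 SB) Ba.
Qed.

Lemma word_nil (I : Type) : @word I [::] = 1. Proof. by rewrite /word big_nil. Qed.
Lemma word_cons (I : Type) (x : I * A) l : word (x :: l) = x.2 * word l.
Proof. by rewrite /word big_cons. Qed.
Lemma word_cat (I : Type) (l1 l2 : seq (I * A)) : word (l1 ++ l2) = word l1 * word l2.
Proof. by rewrite /word big_cat. Qed.

Definition relabel (I J : Type) (f : I -> J) (l : seq (I * A)) :=
  [seq (f p.1, p.2) | p : I * A <- l].

Lemma word_relabel (I J : Type) (f : I -> J) l : word (relabel f l) = word l.
Proof. by rewrite /word big_map. Qed.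

Lemma alternating_relabel (I J : eqType) (f : I -> J)
    (B : I -> A -> Prop) (B' : J -> A -> Prop) l r :
  injective f -> (forall i a, B i a -> B' (f i) a) ->
  alternating B l -> alternating B' r ->
  (forall i, first_label r != Some (f i)) -> alternating B' (relabel f l ++ r).
Proof.
move=> fI BB' Hl Hr rf; elim: l Hl => [//|x l IH] /= [Bx tx xl Hl].
split; [exact: BB'|by []| |exact: IH].
case: l xl {Hl IH} => [|y l] /=; first by rewrite rf.
by rewrite /first_label /= /eq_op /= (inj_eq fI).
Qed.

Lemma free_relabel (I J : eqType) (f : I -> J) (B : I -> A -> Prop) (B' : J -> A -> Prop) :
  injective f -> (forall i a, B i a -> B' (f i) a) ->
  free_family B' -> free_family B.
Proof.
move=> fI BB' F l l0 Hl; rewrite -(word_relabel f); apply: F; first by case: l l0 {Hl}.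
by rewrite -[relabel _ _]cats0; apply: alternating_relabel Hl _ _.
Qed.

(** Associativity of freeness. In an alternating word over [Some i] and [None],
    each maximal run of letters [Some i] is an alternating word for [B]; it
    multiplies to an element of [C] which is centered since [B] is free. The
    word becomes an alternating word for the pair [C], [B0]. *)
Lemma free_assoc (I : eqType) (B : I -> A -> Prop) (C B0 : A -> Prop) :
  (forall i a, B i a -> C a) -> (forall a b, C a -> C b -> C (a * b)) ->
  free_family B -> free_family (fun b : bool => if b then C else B0) ->
  free_family (fun o : option I => if o is Some i then B i else B0).
Proof.
set B3 := fun o : option I => _; set B2 := fun b : bool => _.
move=> BC CM FB F2 l l0 Hl.
have CB u : u != [::] -> alternating B u -> C (word u).
  elim: u => // x u IH _ [Bx _ _ Hu]; rewrite word_cons.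
  case: u IH Hu => [|y u] IH Hu; first by rewrite word_nil mulr1; apply: BC _ _ Bx.
  by apply: CM; [apply: BC _ _ Bx|exact: IH].
(* The regrouped word is [w :: L]; the first run is kept as a word [u], so that
   the induction can extend it by a further letter. *)
suff [w [L [HL <- _]]] : exists w L, [/\ alternating B2 (w :: L), word (w :: L) = word l &
    if first_label l is Some (Some i) then
      exists u, [/\ w = (true, word u), alternating B u & first_label u = Some i]
    else w.1 = false].
  exact: F2 HL.
elim: l l0 Hl => [//|p l IH] _; case: p => o a /= [Ba ta ol Hl].
have [l0|l0] := eqVneq l [::].
  rewrite l0 !word_cons !word_nil /=; case: o Ba {ol} => [i|] Ba.
    exists (true, word [:: (i, a)]), [::]; rewrite !word_cons !word_nil /= mulr1.
    split; [split=> //; exact: BC _ _ Ba|by rewrite mulr1|].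
    by exists [:: (i, a)]; rewrite word_cons word_nil /= mulr1.
  by exists (false, a), [::]; rewrite !word_cons !word_nil.
have [w [L [HL wL lL]]] := IH l0 Hl; case: l l0 ol lL wL {IH Hl} => [//| [p' a'] l] _ /= ol lL wL.
rewrite word_cons /= -wL; case: o Ba ol {wL} => [i|] Ba ol; last first.
  exists (false, a), (w :: L); rewrite !word_cons; split=> //=; split=> //.
  case: p' lL ol => // j [u [wu _ _]] _.
  by rewrite /first_label /= wu.
case: p' ol lL => [j|] ol lL.
  case: lL => u [wu Hu uj]; pose v := (i, a) :: u.
  have Hv : alternating B v by split=> //=; rewrite uj.
  exists (true, word v), L; rewrite [word (_ :: L)]word_cons /= word_cons wu word_cons mulrA; split=> //.
    case: HL => _ _; rewrite wu => wL HL; split=> //.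
      by have := CB v isT Hv; rewrite word_cons.
    by have := FB v isT Hv; rewrite word_cons.
  by exists v; rewrite word_cons.
exists (true, word [:: (i, a)]), (w :: L).
rewrite !word_cons !word_nil /= !mulr1; split=> //.
  by split=> //; [exact: BC _ _ Ba|rewrite /first_label /= lL].
by exists [:: (i, a)]; rewrite word_cons word_nil /= mulr1.
Qed.

(** The algebra generated by a free family is spanned by 1 and the alternating
    words, on which freeness determines the trace. *)
Inductive alg_span (I : eqType) (B : I -> A -> Prop) : A -> Prop :=
| span1 : alg_span B 1
| span_word l : l != [::] -> alternating B l -> alg_span B (word l)
| span_lin c x y : alg_span B x -> alg_span B y -> alg_span B (c *: x + y).

(** A new letter merges with the first letter of the word when their labels
    agree; the product splits into its centered part, which gives alternating
    words again, and a scalar. *)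
Lemma span_mul (I : eqType) (B : I -> A -> Prop) i b x :
  (forall j, subalgebra (B j)) -> B i b -> alg_span B x -> alg_span B (b * x).
Proof.
move=> SB Bb; elim=> {x} [|l l0 Hl|c x y _ Hx _ Hy]; last first.
- by rewrite mulrDr -scalerAr; apply: span_lin; [exact: Hx|exact: Hy].
- have spanw r : alternating B r -> alg_span B (word r).
    by case: r => [_|p r]; [rewrite word_nil; exact: span1|exact: span_word].
  have step a r : B i a -> alternating B r -> first_label r != Some i -> alg_span B (a * word r).
    move=> Ba Hr ri; rewrite (centeredK a) mulrDl -scalerAl mul1r.
    apply: span_lin; first exact: spanw.
    rewrite -(word_cons (i, centered a)); apply: span_word => //=.
    split=> //; [exact: subalg_centered|exact: tr_centered].
  have [li|li] := eqVneq (first_label l) (Some i); last exact: step.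
  case: l l0 Hl li => [//| [j a] l] _ /= [Ba _ jl Hl] [ji]; subst j; rewrite word_cons mulrA.
  by apply: step => //; apply: (subalgM (SB i)).
- rewrite mulr1 (centeredK b); apply: span_lin; first exact: span1.
  rewrite -[centered b]mulr1 -(@word_nil I) -(word_cons (i, centered b)).
  by apply: span_word => //=; split=> //; [exact: subalg_centered|exact: tr_centered].
Qed.

Section MixedMoments.
Variables (I : eqType) (B : I -> A -> Prop) (C : A -> Prop).
Hypothesis free_BC : free_family (fun o : option I => if o is Some i then B i else C).
Hypothesis SC : subalgebra C.
Local Notation lift := (relabel (fun i : I => Some i)).

Let SomeI : injective (fun i : I => Some i). Proof. by move=> ? ? []. Qed.

Lemma tr_free2 a x : alg_span B a -> C x -> tr x = 0 -> tr (a * x) = 0.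
Proof.
move=> Ba Cx tx; elim: Ba => [|l l0 Hl|c y z _ IHy _ IHz].
- by rewrite mul1r.
- rewrite -(word_relabel (fun i : I => Some i)) -[x]mulr1 -(@word_nil (option I)).
  rewrite -(word_cons (None, x)) -word_cat; apply: free_BC.
    by case: (l) l0.
  by apply: alternating_relabel Hl _ _ => //=.
- by rewrite mulrDl -scalerAl (tr_lin SA) IHy IHz mulr0 addr0.
Qed.

Lemma tr_word_eq0 l : l != [::] -> alternating B l -> tr (word l) = 0.
Proof.
move=> l0 Hl; rewrite -(word_relabel (fun i : I => Some i)); apply: free_BC.
  by case: (l) l0.
by rewrite -[relabel _ _]cats0; apply: alternating_relabel Hl _ _.
Qed.

Lemma tr_free_word l x : alternating B l -> l != [::] -> C x -> tr (word l * x) = 0.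
Proof.
move=> Hl l0 Cx; rewrite (centeredK x) mulrDr (trD SA) -scalerAr mulr1 (trZ SA).
rewrite tr_word_eq0 // mulr0 add0r tr_free2 ?tr_centered //; first exact: span_word.
exact: subalg_centered.
Qed.

(** For alternating words [a] and [b] the word [a x b y] is alternating. When one
    of them is 1, two letters of [C] meet, and their product is centered up to
    the scalar [tr (x * y)]. *)
Lemma tr_free4 a b x y : alg_span B a -> alg_span B b -> C x -> C y ->
  tr x = 0 -> tr y = 0 -> tr (a * x * b * y) = tr a * tr b * tr (x * y).
Proof.
move=> Ba Bb Cx Cy tx ty; elim: Ba => [|la la0 Ha|c z w _ IHz _ IHw]; last first.
- have -> : (c *: z + w) * x * b * y = c *: (z * x * b * y) + w * x * b * y.
    by rewrite !mulrDl -!scalerAl.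
  by rewrite !(tr_lin SA) IHz IHw; ring.
- elim: Bb => [|lb lb0 Hb|c z w _ IHz _ IHw]; last first.
  + have -> : word la * x * (c *: z + w) * y =
        c *: (word la * x * z * y) + word la * x * w * y.
      by rewrite !mulrDr !mulrDl -!scalerAr -!scalerAl.
    by rewrite !(tr_lin SA) IHz IHw; ring.
  + rewrite (tr_word_eq0 la0 Ha) !mul0r.
    rewrite -(word_relabel (fun i : I => Some i) la) -(word_relabel (fun i : I => Some i) lb).
    rewrite -[y]mulr1 -(@word_nil (option I)) -!mulrA -(word_cons (None, y)) -word_cat.
    rewrite -(word_cons (None, x)) -word_cat; apply: free_BC; first by case: (la) la0.
    apply: alternating_relabel Ha _ _ => //=; split=> //.
      by case: (lb) lb0.
    by apply: alternating_relabel Hb _ _ => //=.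
  + by rewrite mulr1 -mulrA tr_free_word ?(tr_word_eq0 la0 Ha) ?mul0r //; exact: subalgM.
- rewrite (tr1 SA) !mul1r; elim: Bb => [|lb lb0 Hb|c z w _ IHz _ IHw]; last first.
  + have -> : x * (c *: z + w) * y = c *: (x * z * y) + x * w * y.
      by rewrite !mulrDr !mulrDl -!scalerAr -!scalerAl.
    by rewrite !(tr_lin SA) IHz IHw; ring.
  + rewrite -mulrA (trC SA) -mulrA tr_free_word ?(tr_word_eq0 lb0 Hb) ?mul0r //.
    exact: subalgM.
  + by rewrite mulr1 (tr1 SA) mul1r.
Qed.

End MixedMoments.
End Freeness.

(** * Alternating words in two projections *)

Section ProjectionWords.
Variables (R : realType) (A : algType R[i]) (star : A -> A) (tr : A -> R[i]).
Hypothesis SA : tracial_star_algebra star tr.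
Local Notation sqn := (sqn star tr).
Local Notation contraction := (bounded_mul star tr 1).
Local Notation is_projection := (is_projection star).

(** The alternating product [D_i D_(i+1) ... D_(i+n-1)], with indices modulo 2. *)
Fixpoint pword (D : bool -> A) (i n : nat) : A :=
  if n is n'.+1 then D (odd i) * pword D i.+1 n' else 1.

Lemma pword_cat (D : bool -> A) i n k : pword D i (n + k) = pword D i n * pword D (i + n) k.
Proof.
elim: n i => [|n IH] i; first by rewrite mul1r addn0.
by rewrite addSn /= IH mulrA addSnnS.
Qed.

Lemma pwordSr (D : bool -> A) i n : pword D i n.+1 = pword D i n * D (odd (i + n)).
Proof. by rewrite -addn1 pword_cat /= mulr1. Qed.

Lemma pword_parity (D : bool -> A) i j n : odd i = odd j -> pword D i n = pword D j n.
Proof. by elim: n i j => [//|n IH] i j ij /=; rewrite ij (IH _ j.+1) //= ij. Qed.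

(** By traciality and idempotence this is the trace of the [k]-th power of
    [D false * D true] when [k > 0]. The word of odd length is preferred as it
    also yields the value [tr (D false)] for [k = 0], and as it is a positive
    element. *)
Definition moment (D : bool -> A) k : R := complex.Re (tr (pword D 0 k.*2.+1)).

Section OnePair.
Variable D : bool -> A.
Hypothesis projD : forall b, is_projection (D b).
Hypothesis trD_eq : tr (D true) = tr (D false).

Lemma pword_star i n : star (pword D i n.+1) = pword D (i + n) n.+1.
Proof.
elim: n i => [|n IH] i; first by rewrite /= !mulr1 addn0; case: (projD (odd i)).
rewrite [pword D i _]/= -/(pword D i.+1 n.+1) (starM SA) IH [in RHS]pwordSr addSnnS; congr (_ * _).
by rewrite (proj1 (projD _)) !oddD addbK.
Qed.

(** Palindromes: the two middle letters coincide and merge. *)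
Lemma star_pword_mul i n :
  star (pword D i n.+1) * pword D i n.+1 = pword D (i + n) n.*2.+1.
Proof.
have par : odd (i + n + n) = odd i by rewrite !oddD addbK.
rewrite pword_star -addnn -addnS pword_cat (pword_parity _ _ par) pwordSr par /=.
by rewrite -mulrA (mulrA (D _)) (proj2 (projD _)).
Qed.

Lemma tr_pword_rot i k : tr (pword D i k.*2) = tr (pword D i.+1 k.*2).
Proof.
case: k => [//|k]; rewrite doubleS [in LHS]/= -/(pword D i.+1 _.+1) (trC SA) [in RHS]pwordSr.
by rewrite addSn addnS /= oddD odd_double addbF negbK.
Qed.

Lemma tr_pword_even i j k : tr (pword D i k.*2) = tr (pword D j k.*2).
Proof.
have H i' : tr (pword D i' k.*2) = tr (pword D 0 k.*2).
  by elim: i' => // i' <-; rewrite -tr_pword_rot.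
by rewrite (H i) (H j).
Qed.

Lemma tr_pword_oddS i k : tr (pword D i k.*2.+3) = tr (pword D i.+1 k.*2.+2).
Proof.
rewrite [in LHS]/= -/(pword D i.+1 _.+2) (trC SA) pwordSr -mulrA.
have -> : odd (i.+1 + k.*2.+1) = odd i by rewrite addSn addnS /= oddD odd_double addbF negbK.
by rewrite (proj2 (projD _)).
Qed.

Lemma tr_pword_odd i j k : tr (pword D i k.*2.+1) = tr (pword D j k.*2.+1).
Proof.
case: k => [|k]; first by rewrite /= !mulr1; case: (odd i); case: (odd j).
by rewrite doubleS !tr_pword_oddS -doubleS; apply: tr_pword_even.
Qed.

(** The words of lengths [2 k] and [2 k + 1] all have the same trace: an even word
    can be rotated, and an odd word of length at least 3 begins and ends with
    the same projection. *)
Lemma tr_pword i n : tr (pword D i n.+1) = (moment D n.+1./2)%:C.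
Proof.
have H k j : tr (pword D j k.*2.+1) = (moment D k)%:C.
  rewrite (tr_pword_odd j 0) /moment.
  have := tr_ge0 SA (pword D 0 k.+1); rewrite star_pword_mul (tr_pword_odd _ 0).
  exact: ge0_complex.
have [k [->|->]] : exists k, n.+1 = k.*2.+1 \/ n.+1 = k.+1.*2.
  exists n./2; have := odd_double_half n; case: (odd n) => E; [right|left];
  by rewrite -[in LHS]E ?doubleS.
- by rewrite H /= uphalf_double.
- by rewrite (tr_pword_even i 1) doubleK doubleS -(tr_pword_oddS 0) -doubleS H.
Qed.

Lemma contraction_pword i n : contraction (pword D i n).
Proof.
elim: n i => [|n IH] i; first exact: contraction1.
by apply: contractionM (IH _); apply: contraction_projection.
Qed.

Lemma sqn_pwordE i n : sqn (pword D i n.+1) = moment D n.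
Proof. by rewrite sqnE star_pword_mul tr_pword /= uphalf_double. Qed.

Lemma moment_ge0 n : 0 <= moment D n.
Proof. by rewrite -(sqn_pwordE 0) sqn_ge0. Qed.

Lemma moment_noninc n : moment D n.+1 <= moment D n.
Proof.
rewrite -(sqn_pwordE 1) -(sqn_pwordE 0) [leRHS](sqn_pythagoras SA _ (projD true)).
by rewrite (pword_parity D n.+1 (i := 0) (j := 2)) // lerDl sqn_ge0.
Qed.

End OnePair.

Section Complement.
Variable D : bool -> A.
Hypothesis projD : forall b, is_projection (D b).
Hypothesis trD_eq : tr (D true) = tr (D false).
Let C b := 1 - D b.

(** From [C_i D_i = 0] one gets [C_i D_j D_i = - C_i C_j D_i]; this replaces the
    letters by their complements one after the other, up to the last. *)
Lemma complement_pword i n :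
  C (odd i) * pword D i.+1 n.+1 = ((-1) ^+ n : R)%:C *: (pword C i n.+1 * D (odd (i + n.+1))).
Proof.
elim: n i => [|n IH] i; first by rewrite /= !mulr1 scale1r addn1.
have -> : C (odd i) * pword D i.+1 n.+2 = - (C (odd i) * (C (odd i.+1) * pword D i.+2 n.+1)).
  have E b c : C b * D c * D b = - (C b * C c * D b).
    have CD : C b * D b = 0 by rewrite mulrBl mul1r (proj2 (projD _)) subrr.
    have -> : C b * C c = C b - C b * D c by rewrite {2}/C mulrBr mulr1.
    by rewrite (mulrBl (D b) (C b)) CD sub0r opprK.
  by rewrite /= negbK !mulrA E mulNr.
by rewrite IH -scalerAr addSnnS exprS mulN1r rmorphN scaleNr [pword C i _]/= -/(pword C i.+1 n.+1) mulrA.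
Qed.

(** The decrements of the two sequences of moments agree. A decrement is the
    squared 2-norm of the part of a word cut off by the next projection, and
    [complement_pword] identifies these parts up to sign and adjoint. *)
Lemma moment_complement n : moment C n = moment D n + 1 - complex.Re (tr (D false)) *+ 2.
Proof.
have projC b : is_projection (C b) by exact: (projectionC SA (projD b)).
have trC_eq : tr (C true) = tr (C false) by rewrite /C !(trB SA) trD_eq.
elim: n => [|n IH].
  by rewrite /moment /= !mulr1 /C (trB SA) (tr1 SA) ReB /=; ring.
have E i : sqn (C (odd i) * pword D i.+1 n.+1) = sqn (D (odd (i + n.+1)) * pword C (i + n.+2) n.+1).
  rewrite complement_pword (sqnZ SA) -exprM mulnC exprM sqrrN expr1n expr1n mul1r.
  rewrite -(sqn_star SA) (starM SA) (pword_star projC) (proj1 (projD _)).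
  by congr (sqn (_ * _)); apply: pword_parity; rewrite !oddD /= !negbK.
have H0 := sqn_pythagoras SA (pword D 1 n.+1) (projD false).
have H1 := sqn_pythagoras SA (pword C n.+2 n.+1) (projC (odd (n.+1))).
have H2 := E 0%N; rewrite !add0n /= in H2.
have CC : 1 - C (odd n.+1) = D (odd n.+1) by rewrite /C opprB addrC subrK.
move: H1; rewrite CC.
have -> : C (odd n.+1) * pword C n.+2 n.+1 = pword C n.+1 n.+2 by [].
rewrite !(sqn_pwordE projC trC_eq).
move: H0; have -> : D false * pword D 1 n.+1 = pword D 0 n.+2 by [].
rewrite !(sqn_pwordE projD trD_eq) -/(C false) H2 -/(odd n.+1) => H0 H1.
rewrite -[moment C n.+1](addrK (sqn (D (odd n.+1) * pword C n.+2 n.+1))) -H1 IH H0 /=; ring.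
Qed.

Lemma moment_lower n : complex.Re (tr (D false)) *+ 2 - 1 <= moment D n.
Proof.
have projC b : is_projection (C b) by exact: (projectionC SA (projD b)).
have trC_eq : tr (C true) = tr (C false) by rewrite /C !(trB SA) trD_eq.
have := moment_ge0 projC trC_eq n; rewrite moment_complement; lra.
Qed.
End Complement.
End ProjectionWords.

(** * Second-order expansion of a perturbed word *)

Section Expansion.
Variables (R : realType) (A : algType R[i]) (star : A -> A) (tr : A -> R[i]).
Hypothesis SA : tracial_star_algebra star tr.
Local Notation sqn := (sqn star tr).
Local Notation nrm := (nrm star tr).
Local Notation bounded_mul := (bounded_mul star tr).
Local Notation contraction := (bounded_mul 1).
Variable D : bool -> A.
Hypothesis projD : forall b, is_projection star (D b).
Variable x : bool -> A.
Let E b := D b * (1 + x b).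

(** The sum over the positions [p] of the words in which the letter at [p] is
    followed by an increment, the letters before [p] are unperturbed, and the
    remaining ones are read in [G]. *)
Definition insertion (G : nat -> nat -> A) (i n : nat) : A :=
  \sum_(p < n) pword D i p.+1 * x (odd (i + p)) * G (i + p).+1 (n - p.+1)%N.

(** Duhamel's formula: split a perturbed word at its first increment. *)
Lemma pword_duhamel i n : pword E i n = pword D i n + insertion (pword E) i n.
Proof.
elim: n i => [|n IH] i; first by rewrite /insertion big_ord0 addr0.
rewrite /insertion big_ord_recl /= addn0 subn1 /= mulr1.
have -> y : E (odd i) * y = D (odd i) * y + D (odd i) * x (odd i) * y.
  by rewrite /E mulrDr mulr1 mulrDl.
rewrite {1}IH mulrDr -addrA; congr (_ + _); rewrite addrC; congr (_ + _).
rewrite /insertion mulr_sumr; apply: eq_bigr => p _.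
by rewrite /bump /= !add1n addnS !mulrA subSS.
Qed.

Lemma eq_insertion G G' i n : (forall i n, G i n = G' i n) -> insertion G i n = insertion G' i n.
Proof. by move=> GG; apply: eq_bigr => p _; rewrite GG. Qed.

Lemma insertionD G G' i n :
  insertion (fun i n => G i n + G' i n) i n = insertion G i n + insertion G' i n.
Proof. by rewrite -big_split; apply: eq_bigr => p _; rewrite mulrDr. Qed.

(** Taylor's formula, by iterating Duhamel's formula. *)
Lemma pword_expansion i n : pword E i n = pword D i n + insertion (pword D) i n +
  insertion (insertion (pword D)) i n + insertion (insertion (insertion (pword E))) i n.
Proof.
rewrite pword_duhamel (eq_insertion _ _ pword_duhamel) insertionD -!addrA; do 2 congr (_ + _).
rewrite -insertionD -(eq_insertion _ _ (insertionD _ _)).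
by apply: eq_insertion => j m; apply: eq_insertion; exact: pword_duhamel.
Qed.

Section Remainder.
Variables (K e e2 : R).
Hypothesis K1 : 1 <= K.
Hypothesis boundE : forall b, bounded_mul K (E b).
Hypothesis x_small : forall b, nrm (x b) <= e.
Hypothesis x_pair : forall a b c, contraction a -> nrm (x b * a * x c) <= e2.

Let K0 : 0 <= K := le_trans ler01 K1.
Let e0 : 0 <= e := le_trans (nrm_ge0 _ _ _) (x_small true).
Let e20 : 0 <= e2 := le_trans (nrm_ge0 _ _ _) (x_pair true true (contraction1 _ _)).

Lemma bounded_pword i n : bounded_mul (K ^+ n) (pword E i n).
Proof.
elim: n i => [|n IH] i; first exact: contraction1.
by rewrite exprS; apply: bounded_mulM; rewrite ?exprn_ge0.
Qed.

Lemma expK_le k n : (k <= n)%N -> K ^+ k <= K ^+ n.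
Proof. by move=> kn; apply: ler_weXn2l. Qed.

(** Two increments are paired here, [x b] and the first one of the insertion. *)
Lemma nrm_insertion1 a b i n : contraction a ->
  nrm (x b * a * insertion (pword E) i n) <= n%:R * (K ^+ n * e2).
Proof.
move=> ca; rewrite mulr_sumr; apply: nrm_sum_le => // p.
have := contraction_pword SA projD i p.+1; move: (pword D i p.+1) => w cw.
rewrite !mulrA -(mulrA (x b)).
apply: le_trans (@bounded_pword (i + p).+1 (n - p.+1)%N _).2 _.
apply: ler_pM; rewrite ?exprn_ge0 ?nrm_ge0 ?expK_le ?leq_subr //.
by apply: x_pair; apply: contractionM.
Qed.

Lemma nrm_insertion2 i n :
  nrm (insertion (insertion (pword E)) i n) <= n%:R * (n%:R * (K ^+ n * e2)).
Proof.
apply: nrm_sum_le => // p; rewrite -mulrA.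
apply: le_trans ((contraction_pword SA projD i p.+1) _).1 _; rewrite mul1r.
rewrite -[x _]mulr1; apply: le_trans (nrm_insertion1 _ _ _ (contraction1 _ _)) _.
by apply: ler_pM; rewrite ?mulr_ge0 ?exprn_ge0 // ?ler_nat ?leq_subr // ler_wpM2r ?expK_le ?leq_subr.
Qed.

(** Cauchy-Schwarz separates the first increment, of size [e], from the other
    two, which together have size [e2]. *)
Lemma remainder_le i n :
  `|Re (tr (insertion (insertion (insertion (pword E))) i n))| <=
    n%:R ^+ 3 * K ^+ n * (e * e2).
Proof.
have -> : n%:R ^+ 3 * K ^+ n * (e * e2) = n%:R * (e * (n%:R * (n%:R * (K ^+ n * e2)))) :> R by ring.
rewrite /insertion -/insertion (tr_sum SA) Re_sum.
rewrite -[X in _ <= X%:R * _]card_ord mulr_natl -sumr_const.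
apply: le_trans (ler_norm_sum _ _ _) _; apply: ler_sum => p _.
set u := pword D i p.+1 * _; rewrite -[u](starK SA).
apply: le_trans (Re_cauchy_schwarz SA _ _) _; apply: ler_pM; rewrite ?nrm_ge0 //.
  rewrite nrm_star // (le_trans ((contraction_pword SA projD i p.+1) _).1) // mul1r.
  exact: x_small.
apply: le_trans (nrm_insertion2 _ _) _.
have mn : (n - p.+1)%:R <= n%:R :> R by rewrite ler_nat leq_subr.
by rewrite !ler_pM ?mulr_ge0 ?exprn_ge0 // ?expK_le ?leq_subr.
Qed.
End Remainder.

Section SecondOrder.
Variables (I : eqType) (B : I -> A -> Prop) (C : A -> Prop).
Hypothesis free_BC : free_family tr (fun o : option I => if o is Some i then B i else C).
Hypothesis SC : subalgebra C.
Hypothesis spanD : forall b a, alg_span tr B a -> alg_span tr B (D b * a).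
Hypothesis Cx : forall b, C (x b).
Hypothesis tr_x : forall b, tr (x b) = 0.

Lemma span_pword_mul i n a : alg_span tr B a -> alg_span tr B (pword D i n * a).
Proof.
move=> Ba; elim: n i => [|n IH] i /=; first by rewrite mul1r.
by rewrite -mulrA; apply: spanD.
Qed.

Lemma span_pword i n : alg_span tr B (pword D i n).
Proof. by rewrite -[pword _ _ _]mulr1; apply: span_pword_mul; exact: span1. Qed.

Lemma tr_insertion1 i n : tr (insertion (pword D) i n) = 0.
Proof.
rewrite (tr_sum SA) big1 // => p _; rewrite (trC SA) mulrA.
by apply: (tr_free2 SA free_BC) => //; apply: span_pword_mul; exact: span_pword.
Qed.

Hypothesis trD_eq : tr (D true) = tr (D false).
Variables (s v : R).
Hypothesis tr_xx : forall b, tr (x b * x b) = s%:C.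
Hypothesis tr_xxN : forall b, tr (x b * x (~~ b)) = v%:C.

(** The trace of a word with two increments at distance [q + 1] in a cyclic word
    of length [N]: the covariance of the increments times the traces of the two
    arcs that they cut out. *)
Definition pair_weight N q : R :=
  (if odd q then s else v) * moment tr D q.+1./2 * moment tr D (N - q.+1)./2.

(** Freeness factors the word with two increments into its two arcs; the outer
    arc closes up cyclically since the total length is even. *)
Lemma tr_insertion2 M : tr (insertion (insertion (pword D)) 0 M.*2) =
  (\sum_(p < M.*2) \sum_(q < M.*2 - p.+1) pair_weight M.*2 q)%:C.
Proof.
rewrite (tr_sum SA) rmorph_sum; apply: eq_bigr => p _.
rewrite mulr_sumr (tr_sum SA) rmorph_sum; apply: eq_bigr => q _; rewrite add0n.
have qM : (q.+1 < M.*2)%N by have := ltn_ord q; have := ltn_ord p; lia.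
have cyc w1 w2 w3 y z : tr (w1 * y * (w2 * z * w3)) = tr (w3 * w1 * y * w2 * z).
  by rewrite !mulrA (trC SA) !mulrA.
rewrite cyc (tr_free4 SA free_BC SC) ?tr_x //; [|exact: span_pword_mul (span_pword _ _)|exact: span_pword].
have -> : tr (x (odd p) * x (odd (p.+1 + q))) = (if odd q then s else v)%:C.
  by rewrite addSn /= oddD; case: (odd q); rewrite ?addbT ?addbF ?negbK ?tr_xx ?tr_xxN.
have -> : pword D 0 p.+1 = pword D (M.*2) p.+1 by apply: pword_parity; rewrite odd_double.
have E1 : M.*2 = ((p.+1 + q).+1 + (M.*2 - p.+1 - q.+1))%N by have := ltn_ord q; have := ltn_ord p; lia.
rewrite [X in pword D X p.+1]E1 -pword_cat.
have -> : (M.*2 - p.+1 - q.+1 + p.+1 = (M.*2 - q.+1).-1.+1)%N by have := ltn_ord q; have := ltn_ord p; lia.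
rewrite !(tr_pword SA projD trD_eq) prednK ?subn_gt0 //.
by rewrite /pair_weight !rmorphM /=; ring.
Qed.

End SecondOrder.
End Expansion.

(** A sum over the pairs of points on a circle, according to their distance. *)
Lemma triangle_sum (R : comRingType) L (g : nat -> R) :
  (forall q, (q < L)%N -> g q = g (L - q.+1)%N) ->
  (\sum_(p < L.+1) \sum_(q < L.+1 - p.+1) g q) *+ 2 = L.+1%:R * \sum_(q < L) g q.
Proof.
move=> gs; rewrite mulr2n; rewrite [X in X + _](reindex_inj rev_ord_inj) /=.
have E (p : 'I_L.+1) : \sum_(q < L.+1 - p.+1) g q = \sum_(p <= q < L) g q.
  have pL : (p <= L)%N by rewrite -ltnS.
  rewrite subSS -(big_mkord xpredT g) [RHS]big_nat_rev /=.
  rewrite -[X in _ = \sum_(X <= _ < _) _]add0n big_addn; apply: eq_big_nat => q /andP[_ qL].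
  by rewrite gs; [congr g; lia|lia].
rewrite (eq_bigr (fun p : 'I_L.+1 => \sum_(0 <= q < p) g q)); last first.
  by move=> p _; rewrite big_mkord subSS subKn // -ltnS.
rewrite [X in _ + X](eq_bigr (fun p : 'I_L.+1 => \sum_(p <= q < L) g q)); last first.
  by move=> p _; exact: E.
rewrite -big_split /= (eq_bigr (fun=> \sum_(0 <= q < L) g q)).
  by rewrite sumr_const card_ord mulr_natl big_mkord.
by move=> p _; rewrite -big_cat_nat //= -ltnS.
Qed.

Lemma parity_sum (R : nmodType) N (g : nat -> R) :
  \sum_(q < N.*2.+1) g q = \sum_(k < N.+1) g k.*2 + \sum_(k < N) g k.*2.+1.
Proof.
elim: N => [|N IH]; first by rewrite !big_ord_recr !big_ord0 /= add0r addr0.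
rewrite doubleS 2!big_ord_recr /= IH [in RHS]big_ord_recr [X in _ = _ + X]big_ord_recr /= doubleS.
by rewrite -[LHS]addrA [X in _ + X = _]addrC addrACA.
Qed.

(** * One small step of liberation *)

Section ExpBounds.
Variable R : realType.
Implicit Types h y : R.

Lemma expRN_le y : 0 <= y -> expR (- y) <= 1 - y + y ^+ 2.
Proof.
move=> y0; rewrite expRN -[_^-1]mul1r ler_pdivrMr ?expR_gt0 //.
have Z0 : 0 <= 1 - y + y ^+ 2 by nra.
apply: le_trans (ler_wpM2l Z0 (expR_ge1Dx y)).
by rewrite -subr_ge0 (_ : _ - 1 = y ^+ 3) ?exprn_ge0 //; ring.
Qed.

Lemma expR_le y : 0 <= y <= 2^-1 -> expR y <= 1 + y + 2 * y ^+ 2.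
Proof.
move=> /andP[y0 y1]; rewrite -[X in expR X]opprK expRN -[_^-1]mul1r ler_pdivrMr ?expR_gt0 //.
have Z0 : 0 <= 1 + y + 2 * y ^+ 2 by nra.
apply: le_trans (ler_wpM2l Z0 (expR_ge1Dx (- y))).
rewrite -subr_ge0 (_ : _ - 1 = y ^+ 2 * (1 - 2 * y)); last by ring.
by rewrite mulr_ge0 ?sqr_ge0 //; lra.
Qed.
End ExpBounds.

Section LiberationStep.
Variables (R : realType) (A : algType R[i]) (star : A -> A) (tr : A -> R[i]).
Hypothesis SA : tracial_star_algebra star tr.
Local Notation nrm := (nrm star tr).
Local Notation bounded_mul := (bounded_mul star tr).
Local Notation contraction := (bounded_mul 1).
Variable D : bool -> A.
Hypothesis projD : forall b, is_projection star (D b).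
Hypothesis trD_eq : tr (D true) = tr (D false).
Variables (I : eqType) (B : I -> A -> Prop) (C : A -> Prop).
Hypothesis free_BC : free_family tr (fun o : option I => if o is Some i then B i else C).
Hypothesis SC : subalgebra C.
Hypothesis spanD : forall b a, alg_span tr B a -> alg_span tr B (D b * a).
Variables (z : bool -> A) (h : R).
Hypothesis Cz : forall b, C (z b).
Hypothesis star_z : forall b, star (z b) = z (~~ b).
Hypothesis zzN : forall b, z b * z (~~ b) = 1.
Hypothesis tr_z : forall b, tr (z b) = (expR (- h / 2))%:C.
Hypothesis tr_zz : forall b, tr (z b * z b) = (expR (- h) * (1 - h))%:C.
Hypothesis h_bnd : 0 <= h <= 4^-1.

(** Only the pair matters up to conjugation, so one of the two projections stays
    fixed. *)
Definition liberate b := if b then z false * D true * z true else D false.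

(* With [z = c (1 + x)] the covariances of the centered [x] are exactly [- h] and
   [expR h - 1]. *)
Let c := expR (- h / 2).
Let x b := (c^-1)%:C *: z b - 1.
Let E b := D b * (1 + x b).

Let c0 : 0 < c. Proof. exact: expR_gt0. Qed.
Let cK : c * c^-1 = 1. Proof. by rewrite mulfV // gt_eqF. Qed.
Let c2 : c ^+ 2 = expR (- h). Proof. by rewrite -expRM_natl; congr expR; field. Qed.
Let cV2 : c^-1 ^+ 2 = expR h. Proof. by rewrite exprVn c2 expRN invrK. Qed.
Let h0 : 0 <= h. Proof. by case/andP: h_bnd. Qed.
Let h4 : h <= 4^-1. Proof. by case/andP: h_bnd. Qed.

Let onex b : 1 + x b = (c^-1)%:C *: z b.
Proof. by rewrite /x addrC subrK. Qed.

Lemma liberate_projection b : is_projection star (liberate b).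
Proof.
case: b; last exact: projD; split; rewrite /liberate.
  by rewrite !(starM SA) !star_z (proj1 (projD _)) mulrA.
rewrite !mulrA -(mulrA _ (z true)) (zzN true) mulr1 -(mulrA _ (D true) (D true)).
by rewrite (proj2 (projD _)).
Qed.

(** Regroup [D0 (z D1 z^-1) D0 (z D1 z^-1) ...] as [(D0 z) (D1 z^-1) (D0 z) ...]: each
    letter is followed by its own increment. *)
Lemma pword_liberate k :
  pword liberate 0 k.*2 = pword (fun b => D b * z b) 0 k.*2.
Proof.
elim: k => [//|k IH]; rewrite doubleS /=.
rewrite (pword_parity liberate _ (j := 0)) // (pword_parity _ _ (i := 2) (j := 0)) // IH.
by rewrite !mulrA.
Qed.

Lemma pwordZ (a : R[i]) (F : bool -> A) i n :
  pword (fun b => a *: F b) i n = a ^+ n *: pword F i n.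
Proof.
elim: n i => [|n IH] i /=; first by rewrite scale1r.
by rewrite IH -scalerAl -scalerAr scalerA exprS.
Qed.

Lemma moment_liberate N : moment tr liberate N.+1 =
  expR (- (N.+1%:R * h)) * Re (tr (pword E 0 N.+1.*2)).
Proof.
rewrite /moment doubleS (tr_pword_oddS SA liberate_projection) -doubleS.
rewrite (tr_pword_even SA _ 1 0) pword_liberate.
have -> : pword (fun b => D b * z b) 0 N.+1.*2 = pword (fun b => c%:C *: E b) 0 N.+1.*2.
  have H i n : pword (fun b => D b * z b) i n = pword (fun b => c%:C *: E b) i n.
    elim: n i => [//|n IH] i /=; rewrite IH; congr (_ * _).
    by rewrite /E onex -scalerAr scalerA -rmorphM cK scale1r.
  exact: H.
rewrite pwordZ (trZ SA) -rmorphXn ReZ; congr (_ * _).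
by rewrite -mul2n exprM c2 -expRM_natl mulrN.
Qed.

Let Cx b : C (x b).
Proof.
rewrite /x addrC -[- 1]scaleN1r; apply: (subalg_lin SC) (subalg1 SC) _.
have -> : (c^-1)%:C *: z b = ((c^-1)%:C - 1) *: z b + z b.
  by rewrite -{3}[z b]scale1r -scalerDl subrK.
exact: (subalg_lin SC).
Qed.

Let tr_x b : tr (x b) = 0.
Proof. by rewrite (trB SA) (trZ SA) (tr1 SA) tr_z -rmorphM mulVf ?gt_eqF // subrr. Qed.

Let s := - h.
Let v := expR h - 1.

Let tr_prod b b' : tr (x b * x b') = (c^-1 ^+ 2)%:C * tr (z b * z b') - 1.
Proof.
rewrite /x mulrBl mul1r (mulrBr (_ *: _)) mulr1 -scalerAl -scalerAr scalerA.
rewrite !(trB SA) !(trZ SA) (tr1 SA) !tr_z -!rmorphM mulVf ?gt_eqF // subrr subr0.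
by rewrite expr2.
Qed.

Let tr_xx b : tr (x b * x b) = s%:C.
Proof.
rewrite tr_prod tr_zz -rmorphM cV2 mulrA -expRD subrr expR0 mul1r.
by rewrite rmorphB rmorph1 /s rmorphN addrAC subrr add0r.
Qed.

Let tr_xxN b : tr (x b * x (~~ b)) = v%:C.
Proof. by rewrite tr_prod zzN (tr1 SA) mulr1 cV2 /v rmorphB rmorph1. Qed.

Let star_x b : star (x b) = x (~~ b).
Proof. by rewrite /x (starB SA) (starZ SA) (star1 SA) conjc_real star_z. Qed.

Let v_bnd : h <= v <= h + 2 * h ^+ 2.
Proof.
have := expR_ge1Dx h; have := @expR_le _ h; rewrite h0 /v /= => H ?; apply/andP; split; first by lra.
by have := H ltac:(move: h4; lra); lra.
Qed.

Let nrm_x b : nrm (x b) <= 2 * Num.sqrt h.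
Proof.
rewrite -ler_sqr ?nnegrE ?nrm_ge0 ?mulr_ge0 ?sqrtr_ge0 // (sqr_nrm SA) exprMn sqr_sqrtr //.
rewrite /sqn star_x -{2}[b]negbK tr_xxN /=.
by move: v_bnd h0 h4 => /andP[_ ?] ? ?; nra.
Qed.

Let nrm_xx b : nrm (x b * x (~~ b)) <= 3 * h.
Proof.
rewrite -ler_sqr ?nnegrE ?nrm_ge0 ?mulr_ge0 // (sqr_nrm SA) /sqn (starM SA) !star_x negbK.
pose k := c^-1.
have -> : x b * x (~~ b) = (k ^+ 2 + 1)%:C *: 1 - k%:C *: (z b + z (~~ b)).
  rewrite /x mulrBl mul1r (mulrBr (_ *: _)) mulr1 -scalerAl -scalerAr scalerA zzN -/k.
  rewrite -rmorphM -expr2 rmorphD rmorph1 scalerDl scale1r scalerDr.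
  by rewrite opprB opprD addrACA.
set y := z b + _.
have tr_y : tr y = (2 * c)%:C by rewrite (trD SA) !tr_z -rmorphD; congr (_%:C); rewrite /c; ring.
have tr_yy : tr (y * y) = ((1 + 1) * (expR (- h) * (1 - h)) + (1 + 1))%:C.
  rewrite mulrDl !mulrDr !(trD SA) !tr_zz zzN -{2}[b]negbK zzN (tr1 SA).
  by rewrite mulrDl mul1r !rmorphD rmorph1; ring.
rewrite mulrBl !mulrBr -!scalerAl -!scalerAr !mul1r !mulr1.
rewrite !(trB SA) !(trZ SA) (tr1 SA) tr_y tr_yy !mulr1 -!rmorphM -!rmorphB /=.
have -> : (k ^+ 2 + 1) * (k ^+ 2 + 1) - (k ^+ 2 + 1) * (k * (2 * c)) -
    (k * ((k ^+ 2 + 1) * (2 * c)) - k * (k * (2 * (expR (- h) * (1 - h)) + 2))) =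
   (k ^+ 2) ^+ 2 - 1 - 2 * h.
  have ck : c * k = 1 by [].
  have kk : k ^+ 2 * expR (- h) = 1 by rewrite /k cV2 -expRD subrr expR0.
  have -> : k * (k * (2 * (expR (- h) * (1 - h)) + 2)) = 2 * (k ^+ 2 * expR (- h)) * (1 - h) + 2 * k ^+ 2 by ring.
  have -> : (k ^+ 2 + 1) * (k * (2 * c)) = 2 * (k ^+ 2 + 1) * (c * k) by ring.
  have -> : k * ((k ^+ 2 + 1) * (2 * c)) = 2 * (k ^+ 2 + 1) * (c * k) by ring.
  by rewrite kk ck; ring.
rewrite /k cV2 -expRM_natl.
have := @expR_le _ (2%:R * h); have -> : 0 <= 2%:R * h <= 2^-1 by move: h0 h4; lra.
by move=> /(_ isT); have := sqr_ge0 h; lra.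
Qed.

Let x_pair a b b' : contraction a -> nrm (x b * a * x b') <= 3 * h.
Proof.
move=> ca; apply: (nrm_sandwich SA) => //; first by rewrite star_x -{2}[b]negbK.
by rewrite star_x.
Qed.

Let boundE b : bounded_mul 2 (E b).
Proof.
have cz : contraction (z b).
  by apply: (contraction_unitary SA); rewrite star_z // -{2}[b]negbK.
have cE : bounded_mul (1 * (c^-1 * 1)) (E b).
  rewrite /E onex; apply: (bounded_mulM) => //; first by rewrite mulr1 invr_ge0 ltW.
    exact: contraction_projection.
  by apply: (bounded_mulZ SA) => //; rewrite invr_ge0 ltW.
have c2' : c^-1 <= 2.
  rewrite /c -expRN mulNr opprK; apply: le_trans (expR_le _) _.
    by move: h0 h4; lra.
  by move: h0 h4; nra.
move: cE; rewrite mul1r mulr1 => cE w; have [l r] := cE w.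
split; [apply: le_trans l _|apply: le_trans r _]; by rewrite ler_wpM2r ?nrm_ge0.
Qed.

Let m := moment tr D.
Variable N : nat.

Lemma Re_tr_pword_perturbed : exists2 r,
  `|r| <= N.+1.*2%:R ^+ 3 * 2 ^+ N.+1.*2 * (6 * (h * Num.sqrt h)) &
  Re (tr (pword E 0 N.+1.*2)) = m N.+1 + N.+1%:R *
    (v * (\sum_(k < N.+1) m k * m (N - k)%N) + s * (\sum_(k < N) m k.+1 * m (N - k)%N)) + r.
Proof.
exists (Re (tr (insertion D x (insertion D x (insertion D x (pword E))) 0 N.+1.*2))).
  have := remainder_le SA projD (ler1n R 2) boundE nrm_x (fun a b b' => @x_pair a b b') 0 N.+1.*2.
  by congr (_ <= _ * _); ring.
rewrite (pword_expansion D) !(trD SA) !ReD (tr_insertion1 SA free_BC spanD Cx tr_x) addr0.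
rewrite (tr_insertion2 SA projD free_BC SC spanD Cx tr_x trD_eq tr_xx tr_xxN).
rewrite doubleS (tr_pword SA projD trD_eq) /= -doubleS doubleK; congr (_ + _ + _).
set g := pair_weight tr D s v N.+1.*2.
have gs q : (q < N.*2.+1)%N -> g q = g (N.*2.+1 - q.+1)%N.
  move=> qN; rewrite /g /pair_weight.
  have -> : (N.*2.+1 - q.+1).+1 = (N.+1.*2 - q.+1)%N by lia.
  have -> : (N.+1.*2 - (N.+1.*2 - q.+1))%N = q.+1 by lia.
  have -> : odd (N.*2.+1 - q.+1) = odd q by rewrite subSS oddB ?odd_double // -ltnS.
  by rewrite mulrAC.
have := triangle_sum gs; rewrite parity_sum -doubleS => H.
have : (\sum_(p < N.+1.*2) \sum_(q < N.+1.*2 - p.+1) g q) *+ 2 = 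
   (N.+1%:R * (\sum_(k < N.+1) g k.*2 + \sum_(k < N) g k.*2.+1)) *+ 2.
  by rewrite H -mul2n natrM; ring.
move=> /eqP; rewrite (inj_eq (pmulrnI (ltn0Sn 1))) => /eqP -> /=.
congr (_ * (_ + _)); rewrite mulr_sumr; apply: eq_bigr => k _; rewrite /g /pair_weight /= ?odd_double /=.
  rewrite uphalf_double -mulrA; congr (_ * (_ * m _)).
  have -> : (N.+1.*2 - k.*2.+1 = (N - k).*2.+1)%N by have := ltn_ord k; lia.
  by rewrite /= uphalf_double.
rewrite doubleK -mulrA; congr (_ * (_ * m _)).
have -> : (N.+1.*2 - k.*2.+2 = (N - k).*2)%N by have := ltn_ord k; lia.
by rewrite doubleK.
Qed.

Definition step_const : R := 4 * N.+1%:R ^+ 3 + N.+1.*2%:R ^+ 3 * 2 ^+ N.+1.*2 * 6.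

Lemma moment_le1 n : m n <= 1.
Proof.
rewrite /m -(sqn_pwordE SA projD trD_eq 0).
have -> : 1 = sqn star tr 1 :> R by rewrite /sqn mulr1 (star1 SA) (tr1 SA).
rewrite -(ler_nrm SA); have := ((contraction_pword SA projD 0 n.+1) 1).1.
by rewrite mulr1 mul1r.
Qed.

Let msum_bnd n (f g : nat -> nat) : (n <= N.+1)%N ->
  0 <= \sum_(k < n) m (f k) * m (g k) <= N.+1%:R.
Proof.
move=> nN; have m0 k : 0 <= m k by apply: (moment_ge0 SA).
apply/andP; split; first by apply: sumr_ge0 => k _; exact: mulr_ge0.
apply: (@le_trans _ _ n%:R); last by rewrite ler_nat.
rewrite -[n in n%:R]card_ord -sumr_const; apply: ler_sum => k _.
by rewrite -[1]mulr1 ler_pM ?moment_le1.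
Qed.

(** The second-order terms of [Re_tr_pword_perturbed] and the factor
    [expR (- (N + 1) h)] combine into the increment of the moment; each
    replacement of an exponential by its linear part costs a multiple of
    [h^2 <= h^(3/2)]. *)
Theorem moment_liberation_step :
  `|moment tr liberate N.+1 - m N.+1 + h * (N.+1%:R * (m N.+1 -
      \sum_(k < N.+1) m k * m (N - k)%N + \sum_(k < N) m k.+1 * m (N - k)%N))| <=
  step_const * (h * Num.sqrt h).
Proof.
have [r rb Er] := Re_tr_pword_perturbed; rewrite moment_liberate Er.
have := @msum_bnd N.+1 id (fun k => N - k)%N (leqnn _).
have := @msum_bnd N succn (fun k => N - k)%N (leqnSn _).
set a := \sum_(k < N.+1) _; set b := \sum_(k < N) _ => /andP[b0 bM] /andP[a0 aM].
have y0 : 0 <= m N.+1 by apply: (moment_ge0 SA).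
have := moment_le1 N.+1; move: (m N.+1) y0 => y y0 y1.
rewrite /step_const; set P := _ * _ * _ in rb; set Q := _ * _ * 6.
have M1 : 1 <= N.+1%:R :> R by rewrite ler1n.
have Mh : 0 <= N.+1%:R * h by rewrite mulr_ge0.
have := expR_ge1Dx (- (N.+1%:R * h)); have := expRN_le Mh.
have w0 := expR_gt0 (- (N.+1%:R * h)).
have w1 : expR (- (N.+1%:R * h)) <= 1 by rewrite expR_le1 oppr_le0.
move: (expR _) w0 w1 => w w0 w1 w2 w3.
set M := N.+1%:R in M1 Mh w2 w3 bM aM *.
have sb : v * a + s * b = v * a - h * b by rewrite /s mulNr.
rewrite {}sb; move/andP: v_bnd => [v1 v2]; move: (v) v1 v2 => u u1 u2.
have -> : w * (y + M * (u * a - h * b) + r) - y + h * (M * (y - a + b)) =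
  (w - 1 + M * h) * y + M * a * (w * u - h) + M * b * (h * (1 - w)) + w * r by ring.
have h2 : h ^+ 2 <= h * Num.sqrt h.
  have hs : h <= Num.sqrt h.
    rewrite -ler_sqr ?nnegrE ?sqrtr_ge0 // sqr_sqrtr // expr2 ler_piMr //; move: h4; lra.
  by rewrite expr2 ler_wpM2l.
have t1 : `|(w - 1 + M * h) * y| <= M ^+ 3 * h ^+ 2.
  rewrite ger0_norm; last by rewrite mulr_ge0 //; lra.
  apply: (@le_trans _ _ (M ^+ 2 * h ^+ 2)); last first.
    by rewrite ler_wpM2r ?sqr_ge0 // ler_weXn2l.
  by rewrite -exprMn -[leRHS]mulr1 ler_pM //; lra.
have t2 : `|w * u - h| <= (M + 1) * h ^+ 2.
  have wu1 : w * h <= w * u by rewrite ler_wpM2l // ltW.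
  have wu2 : w * u <= 1 * u by rewrite ler_wpM2r //; move: h0; lra.
  have wh : (1 - M * h) * h <= w * h by rewrite ler_wpM2r //; lra.
  have h20 := sqr_ge0 h.
  have Mh2 : h ^+ 2 <= M * h ^+ 2 by rewrite ler_peMl.
  rewrite ler_norml; apply/andP; split; nra.
have t2' : `|M * a * (w * u - h)| <= M ^+ 2 * ((M + 1) * h ^+ 2).
  by rewrite normrM ler_pM // ger0_norm ?expr2 ?mulr_ge0 ?ler_wpM2l //; lra.
have t3 : `|M * b * (h * (1 - w))| <= M ^+ 2 * (M * h ^+ 2).
  rewrite ger0_norm ?mulr_ge0 //; try lra.
  rewrite ler_pM ?mulr_ge0 //; try lra; first by rewrite expr2 ler_wpM2l //; lra.
  by rewrite expr2 mulrCA ler_wpM2l //; lra.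
have t4 : `|w * r| <= Q * (h * Num.sqrt h).
  rewrite normrM (gtr0_norm w0); apply: le_trans (_ : 1 * `|r| <= _).
    by rewrite ler_wpM2r.
  by rewrite mul1r (le_trans rb) // /P /Q mulrA.
have M0 : 0 <= M by lra.
have M3 : M ^+ 2 <= M ^+ 3 by rewrite ler_weXn2l.
have M3h : M ^+ 2 * h ^+ 2 <= M ^+ 3 * h ^+ 2 by rewrite ler_wpM2r ?sqr_ge0.
have M4 : 4 * M ^+ 3 * h ^+ 2 <= 4 * M ^+ 3 * (h * Num.sqrt h).
  by rewrite ler_wpM2l // mulr_ge0 // exprn_ge0.
rewrite (le_trans (ler_normD _ _)) // [leRHS]mulrDl lerD //.
apply: le_trans M4; rewrite (le_trans (ler_normD _ _)) //.
apply: le_trans (lerD (le_trans (ler_normD _ _) (lerD t1 t2')) t3) _.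
by move: M3h; lra.
Qed.
End LiberationStep.

(** * The von Neumann algebra as an abstract star-algebra *)

Section Adjoints.
Context {R : realType} {H : completeNormedModType R[i]}.
Variable dot : {dot H for (@Num.conj R[i])}.
Implicit Types (x y : H -> H).

Lemma dot_conj (v w : H) : dot v w = (dot w v)^*%C.
Proof. by rewrite (@hermC _ _ _ _ dot) /= mul1r. Qed.

Lemma dot_eq (v w : H) : (forall u, dot u v = dot u w) -> v = w.
Proof.
move=> e; apply/eqP; rewrite -subr_eq0 -(dnorm_eq0 dot); apply/eqP.
by rewrite linearBr /= e subrr.
Qed.

Lemma adjoint_unique x y y' : is_adjoint dot x y -> is_adjoint dot x y' -> y = y'.
Proof. by move=> xy xy'; apply/funext => w; apply: dot_eq => v; rewrite -xy -xy'. Qed.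

Lemma adj_unique x y : is_adjoint dot x y -> adj dot x = y.
Proof. by move=> xy; apply: xget_subset1 => // y1 y2; exact: adjoint_unique. Qed.

Lemma adjoint_sym x y : is_adjoint dot x y -> is_adjoint dot y x.
Proof. by move=> xy v w; rewrite dot_conj -xy -dot_conj. Qed.
End Adjoints.

Section OperatorAlgebra.
Context {R : realType} {H : completeNormedModType R[i]}.
Variable dot : {dot H for (@Num.conj R[i])}.
Variables (M : set (H -> H)) (tau : (H -> H) -> R[i]).
Hypothesis W : wstar_probability_space dot M tau.

Let SM : star_subalgebra dot M := proj1 (wstar_von_neumann W).

(** The proof of [wstar_probability_space] is a parameter of the type because
    its algebra structure depends on it: closure of [M] under the operations
    comes from there, and so does [1 != 0], through the state. *)
Definition opalg of wstar_probability_space dot M tau := {x : H -> H | x \in M}.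
Local Notation A := (opalg W).
HB.instance Definition _ := Choice.on A.
HB.instance Definition _ := SubType.on A.

Lemma opalg_mem (a : A) : M (val a).
Proof. exact: set_mem (valP a). Qed.

Let mk x (Mx : M x) : A := exist _ x (mem_set Mx).

Let Mid : M idfun. Proof. by case: SM. Qed.
Let Mlin c x y : M x -> M y -> M (fun v => c *: x v + y v).
Proof. by case: SM => _ _ h _ _; apply: h. Qed.
Let Mcomp x y : M x -> M y -> M (x \o y).
Proof. by case: SM => _ _ _ h _; apply: h. Qed.
Let M0 : M (fun=> 0).
Proof.
have := Mlin (-1) Mid Mid; congr M; apply/funext => v /=.
by rewrite scaleN1r addNr.
Qed.
Let MD x y : M x -> M y -> M (fun v => x v + y v).
Proof. by move=> Mx My; have := Mlin 1 Mx My; congr M; apply/funext => v; rewrite scale1r. Qed.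
Let MZ c x : M x -> M (fun v => c *: x v).
Proof. by move=> Mx; have := Mlin c Mx M0; congr M; apply/funext => v; rewrite addr0. Qed.
Let MN x : M x -> M (fun v => - x v).
Proof. by move=> Mx; have := MZ (-1) Mx; congr M; apply/funext => v; rewrite scaleN1r. Qed.
Let Madj x : M x -> M (adj dot x) /\ is_adjoint dot x (adj dot x).
Proof. by case: SM => _ _ _ _ h /h[y My xy]; rewrite (adj_unique xy). Qed.
Let Mlinear x : M x -> linear x.
Proof. by case: SM => h _ _ _ _ /h[]. Qed.

Let add (a b : A) : A := mk (MD (opalg_mem a) (opalg_mem b)).
Let opp (a : A) : A := mk (MN (opalg_mem a)).
Let zero : A := mk M0.
Let one : A := mk Mid.
Let mul (a b : A) : A := mk (Mcomp (opalg_mem a) (opalg_mem b)).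
Let scale (c : R[i]) (a : A) : A := mk (MZ c (opalg_mem a)).

Let addA : associative add.
Proof. by move=> a b c; apply: val_inj; apply/funext => v /=; rewrite addrA. Qed.
Let addC : commutative add.
Proof. by move=> a b; apply: val_inj; apply/funext => v /=; rewrite addrC. Qed.
Let add0 : left_id zero add.
Proof. by move=> a; apply: val_inj; apply/funext => v /=; rewrite add0r. Qed.
Let addN : left_inverse zero opp add.
Proof. by move=> a; apply: val_inj; apply/funext => v /=; rewrite addNr. Qed.
HB.instance Definition _ := GRing.isZmodule.Build A addA addC add0 addN.

Let opalgD (a : A) v w : val a (v + w) = val a v + val a w.
Proof. by rewrite -[v]scale1r (Mlinear (opalg_mem a)) !scale1r. Qed.

Let mulA : associative mul.
Proof. by move=> a b c; apply: val_inj. Qed.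
Let mul1 : left_id one mul. Proof. by move=> a; apply: val_inj. Qed.
Let mulr1 : right_id one mul. Proof. by move=> a; apply: val_inj. Qed.
Let mulDl : left_distributive mul add.
Proof. by move=> a b c; apply: val_inj. Qed.
Let mulDr : right_distributive mul add.
Proof. by move=> a b c; apply: val_inj; apply/funext => v /=; rewrite opalgD. Qed.
Let one_neq0 : one != 0.
Proof.
apply/eqP => /(congr1 val) /= e.
have := state_linear (wstar_state W) (-1) Mid Mid.
have -> : (fun v : H => -1 *: idfun v + idfun v) = idfun.
  apply/funext => v; rewrite /= scaleN1r addNr.
  by have := congr1 (@^~ v) e.
rewrite (state_unit (wstar_state W)) mulN1r addNr => /eqP.
by rewrite oner_eq0.
Qed.
HB.instance Definition _ := GRing.Zmodule_isNzRing.Build A mulA mul1 mulr1 mulDl mulDr one_neq0.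

Let scaleA c d (a : A) : scale c (scale d a) = scale (c * d) a.
Proof. by apply: val_inj; apply/funext => v /=; rewrite scalerA. Qed.
Let scale1 : left_id 1 scale.
Proof. by move=> a; apply: val_inj; apply/funext => v /=; rewrite scale1r. Qed.
Let scaleDr : right_distributive scale +%R.
Proof. by move=> c a b; apply: val_inj; apply/funext => v /=; rewrite scalerDr. Qed.
Let scaleDl a : {morph scale^~ a: c d / c + d}.
Proof. by move=> c d; apply: val_inj; apply/funext => v /=; rewrite scalerDl. Qed.
HB.instance Definition _ := GRing.Zmodule_isLmodule.Build R[i] A scaleA scale1 scaleDr scaleDl.

Let scaleAl (c : R[i]) (a b : A) : c *: (a * b) = (c *: a) * b.
Proof. by apply: val_inj. Qed.
HB.instance Definition _ := GRing.Lmodule_isLalgebra.Build R[i] A scaleAl.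

Let scaleAr (c : R[i]) (a b : A) : c *: (a * b) = a * (c *: b).
Proof.
apply: val_inj; apply/funext => v /=.
by have := Mlinear (opalg_mem a) c (val b v) 0; rewrite addr0 => ->;
  have := opalgD a 0 0; rewrite addr0 => /eqP; rewrite -subr_eq subrr => /eqP <-; rewrite addr0.
Qed.
HB.instance Definition _ := GRing.Lalgebra_isAlgebra.Build R[i] A scaleAr.

Lemma opalg_valM (a b : A) : val (a * b) = val a \o val b. Proof. by []. Qed.
Lemma opalg_valB (a b : A) v : val (a - b) v = val a v - val b v.
Proof. by []. Qed.
Lemma opalg_linear (a : A) : linear (val a). Proof. exact: Mlinear (opalg_mem a). Qed.

Definition opstar (a : A) : A := mk (proj1 (Madj (opalg_mem a))).
Definition optr (a : A) : R[i] := tau (val a).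

Lemma opstarP (a : A) : is_adjoint dot (val a) (val (opstar a)).
Proof. exact: (proj2 (Madj (opalg_mem a))). Qed.

Lemma opstar_unique (a b : A) : is_adjoint dot (val a) (val b) -> opstar a = b.
Proof. by move=> ab; apply: val_inj; exact: adjoint_unique (opstarP a) ab. Qed.

(** Meaningful for [x] in [M]; other operators are sent to 1. *)
Definition to_opalg (x : H -> H) : A := insubd (1 : A) x.
Lemma to_opalgK x : M x -> val (to_opalg x) = x.
Proof. by move=> Mx; rewrite /to_opalg insubdK //; exact: mem_set. Qed.

Lemma opalg_tracial : tracial_star_algebra opstar optr.
Proof.
have WS := wstar_state W; split.
- move=> c a b; apply: opstar_unique => v w /=.
  rewrite linearDl linearDr /= linearZl_LR linearZr_LR /= !opstarP.
  by congr (_ * _ + _); rewrite conjCK.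
- by move=> a; apply: opstar_unique; apply: adjoint_sym; exact: opstarP.
- by move=> a b; apply: opstar_unique => v w /=; rewrite !opstarP.
- by move=> c a b; apply: (state_linear WS); exact: opalg_mem.
- by move=> a b; apply: (state_tracial WS); exact: opalg_mem.
- by move=> a; apply: (state_ge0 WS); exact: opalg_mem.
- exact: (state_unit WS).
Qed.

Definition generated (S : set (H -> H)) (a : A) := smallest (star_subalgebra dot) S (val a).

Lemma generated_subalgebra S : S `<=` M -> subalgebra (generated S).
Proof.
move=> SM'; split.
- by move=> N [] [_ h _ _ _] _; exact: h.
- move=> c a b Sa Sb N NS; case: (NS) => [[_ _ h _ _] _].
  by apply: h; [exact: Sa|exact: Sb].
- move=> a b Sa Sb N NS; case: (NS) => [[_ _ _ h _] _].
  by apply: h; [exact: Sa|exact: Sb].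
Qed.

Lemma generated_gen (S : set (H -> H)) (a : A) : S (val a) -> generated S a.
Proof. exact: sub_gen_smallest. Qed.

Lemma generated_star S (a : A) : generated S a -> generated S (opstar a).
Proof.
move=> Sa N NS; case: (NS) => [[_ _ _ _ h] _].
have [y Ny ay] := h _ (Sa N NS).
by rewrite (adjoint_unique (opstarP a) ay).
Qed.

Lemma generated_sub (S S' : set (H -> H)) :
  (forall x, S x -> smallest (star_subalgebra dot) S' x) ->
  forall a, generated S a -> generated S' a.
Proof.
move=> SS' a Sa N NS; apply: Sa; split; first by case: NS.
by move=> x /SS'; apply.
Qed.

Lemma free_family_generated (I : eqType) (S : I -> set (H -> H)) :
  star_free dot tau S -> free_family optr (fun i => generated (S i)).
Proof.
move=> F l l0 Hl; case: l l0 Hl => // p l _ Hl; set L := p :: l in Hl *.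
pose i k := (nth p L k).1; pose a k := val (nth p L k).2.
have -> : optr (word L) = tau (\big[comp/idfun]_(0 <= k < size L) a k).
  congr tau; rewrite -(big_nth p xpredT (fun q : I * A => val q.2)).
  elim: L {Hl i a} => [|q L IH]; first by rewrite big_nil word_nil.
  by rewrite big_cons word_cons opalg_valM IH.
suff [F1 F2] : (forall k, (k.+1 < size L)%N -> i k != i k.+1) /\
    (forall k, (k < size L)%N -> smallest (star_subalgebra dot) (S (i k)) (a k) /\ tau (a k) = 0).
  exact: (F (size L) i a isT F1 F2).
rewrite /i /a; elim: (L) Hl => [//|q r IH] /= [Sq tq qr /IH[IH1 IH2]]; split=> -[|k] //=.
- by case: r qr {IH IH1 IH2} => //= q' r; rewrite /first_label /= eq_sym.
- exact: IH1.
- exact: IH2.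
Qed.

End OperatorAlgebra.

(** * Strong limits of powers of a positive contraction *)

Section StrongLimit.
Context {R : realType} {H : completeNormedModType R[i]}.
Variable dot : {dot H for (@Num.conj R[i])}.
Hypothesis hn : hilbert_norm dot.
Implicit Types (v w : H) (x y : H -> H).

Definition sqnorm v : R := Re (dot v v).

Lemma dot_sqnorm v : dot v v = (sqnorm v)%:C.
Proof. by apply: ge0_complex; exact: dnorm_ge0. Qed.

Lemma normr_sqnorm v : `|v| ^+ 2 = (sqnorm v)%:C.
Proof. by rewrite hn dot_sqnorm. Qed.

Lemma sqnorm_ge0 v : 0 <= sqnorm v.
Proof. by apply: ge0_Re; exact: dnorm_ge0. Qed.

Lemma sqnorm_eq0 v : sqnorm v = 0 -> v = 0.
Proof. by move=> v0; apply/eqP; rewrite -(dnorm_eq0 dot) dot_sqnorm v0. Qed.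

Lemma norm_lt v (r : R) : 0 < r -> sqnorm v < r ^+ 2 -> `|v| < r%:C.
Proof.
move=> r0 vr; rewrite -(@ltr_pXn2r _ 2) ?nnegrE ?normr_ge0 ?ler0c ?ltW //.
by rewrite normr_sqnorm -rmorphXn ltcR.
Qed.

Lemma lt_sqnorm v (r : R) : 0 < r -> `|v| < r%:C -> sqnorm v < r ^+ 2.
Proof.
move=> r0; rewrite -(@ltr_pXn2r _ 2) ?nnegrE ?normr_ge0 ?ler0c ?ltW //.
by rewrite normr_sqnorm -rmorphXn ltcR.
Qed.

Lemma Re_dot_sym v w : Re (dot v w) = Re (dot w v).
Proof. by rewrite dot_conj; case: (dot w v). Qed.

Lemma sqnormD v w : sqnorm (v + w) = sqnorm v + Re (dot v w) *+ 2 + sqnorm w.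
Proof.
by rewrite /sqnorm linearDl !linearDr /= !ReD (Re_dot_sym w v); ring.
Qed.

Lemma sqnormZ (c : R) v : sqnorm (c%:C *: v) = c ^+ 2 * sqnorm v.
Proof.
rewrite /sqnorm linearZl_LR linearZr_LR /= ReZ.
have -> : (c%:C)^* = c%:C :> R[i] by apply: conjc_real.
by rewrite ReZ mulrA expr2.
Qed.

Lemma Re_dotZ (c : R) v w : Re (dot v (c%:C *: w)) = c * Re (dot v w).
Proof.
rewrite linearZr_LR /=; have -> : (c%:C)^* = c%:C :> R[i] by apply: conjc_real.
by rewrite ReZ.
Qed.

Lemma dot_cauchy_schwarz v w : Re (dot v w) ^+ 2 <= sqnorm v * sqnorm w.
Proof.
apply: nonneg_quadratic_discriminant; rewrite ?sqnorm_ge0 // => s.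
by have := sqnorm_ge0 (v + s%:C *: w); rewrite sqnormD sqnormZ Re_dotZ; lra.
Qed.

Lemma cvg_Re_dot (u : nat -> H) l w : u @ \oo --> l ->
  (fun n => Re (dot (u n) w)) @ \oo --> Re (dot l w).
Proof.
move=> ul; apply/cvgrPdist_lt => e e0.
pose r := e / (sqnorm w + 1); have w1 : 0 < sqnorm w + 1 by have := sqnorm_ge0 w; lra.
have r0 : 0 < r by rewrite divr_gt0.
have rC0 : 0 < r%:C by rewrite (ltcR 0).
move/cvgrPdist_lt: ul => /(_ _ rC0); apply: filterS => n /(lt_sqnorm r0) un.
rewrite -ReB -linearBl -ltr_sqr ?nnegrE ?(ltW e0) // real_normK ?num_real //.
apply: le_lt_trans (dot_cauchy_schwarz _ _) _.
apply: (@le_lt_trans _ _ (r ^+ 2 * sqnorm w)).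
  by rewrite ler_wpM2r ?sqnorm_ge0 // ltW.
rewrite /r exprMn exprVn -mulrA -[ltRHS]mulr1 ltr_pM2l ?exprn_gt0 //.
rewrite mulrC ltr_pdivrMr ?exprn_gt0 // mul1r; have := sqnorm_ge0 w; nra.
Qed.

Lemma cvg_bounded_op y (u : nat -> H) l : bounded_op y -> u @ \oo --> l ->
  (fun n => y (u n)) @ \oo --> y l.
Proof.
move=> [ylin [C yC]] ul.
have yB v w : y (v - w) = y v - y w.
  by have := ylin (-1) w v; rewrite !scaleN1r !(addrC (- _)).
apply/cvgrPdist_lt => e e0.
have C1 : 0 < `|C| + 1 by rewrite ltr_wpDl.
move/cvgrPdist_lt: ul => /(_ _ (divr_gt0 e0 C1)); apply: filterS => n.
rewrite -yB ltr_pdivlMr // => un.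
apply: le_lt_trans un; apply: le_trans (yC _) _.
have [->|v0] := eqVneq (`|l - u n|) 0; first by rewrite mulr0 mul0r.
have Cr : C \is Num.real.
  have := le_trans (normr_ge0 _) (yC (l - u n)); rewrite pmulr_lge0 ?lt_def ?v0 ?normr_ge0 // => /ger0_real.
  done.
rewrite mulrC ler_wpM2l //; apply: le_trans (real_ler_norm Cr) _.
by rewrite lerDl.
Qed.

Variable a : nat -> H -> H.
Hypothesis a_lin : forall n, linear (a n).
Hypothesis a_sa : forall n, self_adjoint dot (a n).
Hypothesis a_semigroup : forall j k v, a j (a k v) = a (j + k)%N v.
Hypothesis a_ge0 : forall n v, 0 <= Re (dot (a n v) v).
Hypothesis a_noninc : forall n v, Re (dot (a n.+1 v) v) <= Re (dot (a n v) v).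

Lemma sqnorm_a n v : sqnorm (a n v) = Re (dot (a n.*2 v) v).
Proof. by rewrite /sqnorm a_sa a_semigroup addnn Re_dot_sym. Qed.

Lemma a_contraction n v : sqnorm (a n v) <= sqnorm v.
Proof.
have H0 : sqnorm (a n v) <= sqnorm (a 0 v).
  rewrite !sqnorm_a /=; elim: n.*2 => [//|k IH]; exact: le_trans (a_noninc _ _) IH.
apply: le_trans H0 _.
have -> : sqnorm v = sqnorm (a 0 v + (v - a 0 v)) by rewrite addrC subrK.
have o : Re (dot (a 0 v) (v - a 0 v)) = 0.
  by rewrite linearBr /= ReB [dot (a 0 v) (a 0 v)]a_sa a_semigroup Re_dot_sym subrr.
by rewrite sqnormD o mul0rn addr0 lerDl sqnorm_ge0.
Qed.

Lemma a_bounded n : bounded_op (a n).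
Proof.
split; first exact: a_lin.
exists 1 => v; rewrite mul1r -(@ler_pXn2r _ 2) ?nnegrE ?normr_ge0 //.
by rewrite !normr_sqnorm lecR a_contraction.
Qed.

(** Since [a j] and [a k] compose to [a (j + k)], the squared norm of
    [a j v - a k v] only involves the values of the sequence [dot (a n v) v],
    which converges by monotonicity. *)
Lemma a_cauchy v : cvg (a n v @[n --> \oo]).
Proof.
apply/cauchy_cvgP/cauchyP => e e0.
pose r := Re e; have eE : e = r%:C by apply: ge0_complex; exact: ltW.
have r0 : 0 < r by rewrite eE (ltcR 0) in e0.
pose f n := Re (dot (a n v) v).
have fdec : nonincreasing_seq f by apply/nonincreasing_seqP => n; exact: a_noninc.
have flb : has_lbound (range f) by exists 0 => _ [n _ <-]; exact: a_ge0.
have fl := nonincreasing_cvgn fdec flb.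
have d0 : 0 < r ^+ 2 / 4 by rewrite divr_gt0 ?exprn_gt0.
move/cvgrPdist_lt: fl => /(_ _ d0)[N _ HN].
exists (a N v); exists N => // n /= Nn.
rewrite -ball_normE /ball_ /= eE; apply: norm_lt => //.
have -> : sqnorm (a N v - a n v) = f N.*2 - f (N + n)%N *+ 2 + f n.*2.
  have -> : a N v - a n v = a N v + (-1)%:C *: a n v by rewrite rmorphN1 scaleN1r.
  rewrite sqnormD sqnormZ Re_dotZ !sqnorm_a -(a_sa n) a_semigroup addnC /f.
  by rewrite expr2 mulrNN !mul1r mulN1r mulNrn.
have N2 : (N <= N.*2)%N by rewrite -addnn leq_addr.
have n2 : (N <= n.*2)%N by rewrite -addnn (leq_trans Nn) // leq_addr.
have := HN _ N2; have := HN _ n2; have := HN _ (leq_addr n N : (N <= N + n)%N).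
rewrite /= !ltr_norml => /andP[? ?] /andP[? ?] /andP[? ?].
lra.
Qed.

Definition strong_limit v : H := lim (a n v @[n --> \oo]).
Local Notation E := strong_limit.

Lemma strong_limitP v : a n v @[n --> \oo] --> E v.
Proof. exact: a_cauchy. Qed.

Lemma strong_limit_unique v l : a n v @[n --> \oo] --> l -> E v = l.
Proof. by move=> al; exact: (norm_cvg_unique (@strong_limitP v) al). Qed.

Lemma strong_limit_fixed v : (forall n, a n v = v) -> E v = v.
Proof. by move=> av; apply: strong_limit_unique; under eq_fun do rewrite av; exact: cvg_cst. Qed.

Lemma a_strong_limit n v : a n (E v) = E v.
Proof.
symmetry; apply: strong_limit_unique.
have := cvg_bounded_op (a_bounded n) (@strong_limitP v); rewrite -(cvg_shiftn n (fun k => a k v)).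
have -> // : (fun k => a n (a k v)) = (fun k => a (k + n)%N v).
by apply/funext => k; rewrite a_semigroup addnC.
Qed.

Lemma strong_limit_linear : linear E.
Proof.
move=> c v w; apply: strong_limit_unique; under eq_fun do rewrite a_lin.
by apply: cvgD; [apply: cvgZl_tmp; exact: strong_limitP|exact: strong_limitP].
Qed.

Lemma Re_strong_limit v w : Re (dot (E v) w) = Re (dot v (E w)).
Proof.
have c1 := @cvg_Re_dot _ _ w (@strong_limitP v).
have := @cvg_Re_dot _ _ v (@strong_limitP w).
under [X in X @ _ --> _]eq_fun do rewrite Re_dot_sym -a_sa.
by rewrite Re_dot_sym => c2; exact: (norm_cvg_unique c1 c2).
Qed.

Lemma strong_limit_sa : self_adjoint dot E.
Proof.
move=> v w; have e1 := Re_strong_limit v w.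
have e2 := Re_strong_limit ('i *: v) w.
have Ei : E ('i *: v) = 'i *: E v.
  have := strong_limit_linear 'i v 0; rewrite addr0 => ->.
  have := strong_limit_linear (-1) 0 0; rewrite scaleN1r oppr0 addr0 => ->.
  by rewrite scaleN1r addNr addr0.
move: e1 e2; rewrite Ei !linearZl_LR /=.
case: (dot (E v) w) (dot v (E w)) => [p q] [p' q'] /= ->.
by rewrite !mul0r !mul1r !sub0r => /oppr_inj ->.
Qed.

Lemma strong_limit_projection : orthogonal_projection dot E.
Proof.
split; last exact: strong_limit_sa.
- split; first exact: strong_limit_linear.
  exists 1 => v; rewrite mul1r -(@ler_pXn2r _ 2) ?nnegrE ?normr_ge0 //.
  rewrite !normr_sqnorm lecR.
  have := dot_cauchy_schwarz (E v) v.
  have -> : Re (dot (E v) v) = sqnorm (E v).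
    rewrite /sqnorm [in RHS]strong_limit_sa Re_dot_sym.
    by rewrite (strong_limit_fixed (fun n => a_strong_limit n v)).
  have [->|s0] := eqVneq (sqnorm (E v)) 0; first by rewrite sqnorm_ge0.
  by rewrite expr2 ler_pM2l // lt_def s0 sqnorm_ge0.
- by apply/funext => v /=; apply: strong_limit_fixed => n; exact: a_strong_limit.
Qed.

Lemma strong_limit_commute y : bounded_op y -> (forall n v, a n (y v) = y (a n v)) ->
  forall v, E (y v) = y (E v).
Proof.
move=> yb ay v; apply: strong_limit_unique; under eq_fun do rewrite ay.
by apply: cvg_bounded_op => //; exact: strong_limitP.
Qed.

Lemma cvg_Re_strong_limit v : (fun n => Re (dot (a n v) v)) @ \oo --> Re (dot (E v) v).
Proof. exact: cvg_Re_dot (@strong_limitP v). Qed.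

End StrongLimit.

(** * The trace of the meet as the limit of the moments *)

Section MeetTrace.
Context {R : realType} {H : completeNormedModType R[i]}.
Variable dot : {dot H for (@Num.conj R[i])}.
Variables (M : set (H -> H)) (tau : (H -> H) -> R[i]).
Hypothesis W : wstar_probability_space dot M tau.
Local Notation A := (opalg W).
Local Notation star := (@opstar _ _ _ _ _ W).
Local Notation tr := (@optr _ _ _ _ _ W).
Local Notation sqnorm := (sqnorm dot).
Let hn : hilbert_norm dot := wstar_hilbert W.
Let TS : tracial_star_algebra star tr := opalg_tracial W.

Lemma orthogonal_projection_range_unique (x y : H -> H) :
  orthogonal_projection dot x -> orthogonal_projection dot y ->
  range x = range y -> x = y.
Proof.
move=> [_ xx xs] [_ yy ys] xy.
have fx (z z' : H -> H) v : z \o z = z -> range z = range z' -> z (z' v) = z' v.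
  move=> zz zr; have [w _ <-] : range z (z' v) by rewrite zr; exists v.
  exact: (congr1 (@^~ w) zz).
apply/funext => v; apply: (@dot_eq _ _ dot) => w.
rewrite -xs -(fx y x w yy (esym xy)) ys xs (fx x y v xx xy).
by rewrite -[RHS]ys.
Qed.

Lemma opalg_projection (p : A) : orthogonal_projection dot (val p) -> is_projection star p.
Proof. by move=> [_ pp ps]; split; [exact: opstar_unique|exact: val_inj]. Qed.

Lemma is_projection_sa (p : A) : is_projection star p -> self_adjoint dot (val p).
Proof. by move=> [ps _] v w; rewrite (opstarP p) ps. Qed.

Lemma projection_dot_split (p : A) v : is_projection star p ->
  dot v v = dot (val p v) (val p v) + dot (v - val p v) (v - val p v).
Proof.
move=> pp; have ps := is_projection_sa pp.
have ppv : val p (val p v) = val p v by rewrite -[RHS](congr1 (fun q : A => val q v) pp.2).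
have e1 : dot (val p v) (val p v) = dot v (val p v) by rewrite ps ppv.
by rewrite linearBl !linearBr /= e1 ps; ring.
Qed.

Variables (p q : A).
Hypothesis pp : is_projection star p.
Hypothesis qp : is_projection star q.
Hypothesis tr_qp : tr q = tr p.
Let D (b : bool) := if b then q else p.
Let projD b : is_projection star (D b). Proof. by case: b. Qed.

Let a n := val (pword D 0 n.*2.+1).

Let aE n : pword D 0 n.*2.+1 = star (pword D n n.+1) * pword D n n.+1.
Proof. by rewrite (star_pword_mul TS projD); apply: pword_parity; rewrite addnn odd_double. Qed.

Let dot_a n v : dot (a n v) v = dot (val (pword D n n.+1) v) (val (pword D n n.+1) v).
Proof.
by rewrite /a aE; apply: etrans (opstarP (star _) _ _) _; rewrite (starK TS).
Qed.

Let a_step n v : exists u, dot (a n v) v = dot (a n.+1 v) v + dot u u.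
Proof.
rewrite !dot_a (projection_dot_split (val (pword D n n.+1) v) (projD (odd n.+1))).
rewrite (pword_parity D n.+1 (i := n) (j := n.+2)) /= ?negbK //.
by eexists.
Qed.

Let a_lin n : linear (a n). Proof. exact: opalg_linear. Qed.
Let a_sa n : self_adjoint dot (a n).
Proof.
move=> v w; rewrite (opstarP (pword D 0 n.*2.+1)) (pword_star TS projD).
by rewrite (pword_parity D _ (i := 0 + n.*2) (j := 0)) // add0n odd_double.
Qed.
Let a_semigroup j k v : a j (a k v) = a (j + k)%N v.
Proof.
rewrite -[a j (a k v)]/(val (pword D 0 j.*2.+1 * pword D 0 k.*2.+1) v) /a; congr (val _ v).
rewrite doubleD -addnS pword_cat (pwordSr D 0 j.*2) -mulrA add0n odd_double; congr (_ * _).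
rewrite (pword_parity D _ (i := j.*2) (j := 0)) ?odd_double //.
by rewrite [pword D 0 _]/= mulrA (proj2 (projD false)).
Qed.
Let a_ge0 n v : 0 <= Re (dot (a n v) v).
Proof. by rewrite dot_a; exact: sqnorm_ge0. Qed.
Let a_noninc n v : Re (dot (a n.+1 v) v) <= Re (dot (a n v) v).
Proof. by have [u ->] := a_step n v; rewrite ReD lerDl; exact: sqnorm_ge0. Qed.

Let E := strong_limit a.
Let projE : orthogonal_projection dot E.
Proof. exact: (strong_limit_projection hn). Qed.

Let fixed_range (x : A) v : is_projection star x -> range (val x) v -> val x v = v.
Proof. by move=> xp [w _ <-]; rewrite -[RHS](congr1 (fun y : A => val y w) xp.2). Qed.

(* A vector fixed by all the words is fixed by [p] and by [p q p]; then [q] does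
   not decrease its norm, hence fixes it. *)
Let rangeE : range E = range (val p) `&` range (val q).
Proof.
apply/seteqP; split=> [_ [v _ <-]|v [vp vq]].
  have aEv n : a n (E v) = E v by exact: (a_strong_limit hn).
  move: (E v) aEv => u au.
  have pu : val p u = u by exact: (au 0).
  have pqu : val p (val q u) = u.
    have a1 : a 1 u = val p (val q (val p u)) by [].
    by rewrite -[RHS](au 1) a1 pu.
  have qu : val q u = u.
    apply/eqP; rewrite eq_sym -subr_eq0; apply/eqP; apply: (sqnorm_eq0 (dot := dot)).
    have := congr1 (@complex.Re R) (projection_dot_split u qp).
    have := congr1 (@complex.Re R) (projection_dot_split (val q u) pp).
    rewrite !ReD pqu -!/(sqnorm _).
    have := sqnorm_ge0 dot (u - val q u); have := sqnorm_ge0 dot (val q u - u); lra.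
  by split; exists u.
have pv := fixed_range pp vp; have qv := fixed_range qp vq.
exists v => //; apply: (strong_limit_fixed hn a_sa a_semigroup a_ge0 a_noninc) => n; rewrite /a.
elim: n.*2.+1 0%N => [//|k IH] i.
rewrite -[LHS]/(val (D (odd i)) (val (pword D i.+1 k) v)) IH.
by case: (odd i).
Qed.

Lemma meet_projection_strong_limit : meet_projection dot (val p) (val q) = E.
Proof.
apply: xget_subset1; first by split; [exact: projE|exact: rangeE].
by move=> x y [xp xr] [yp yr]; apply: orthogonal_projection_range_unique; rewrite ?xr ?yr.
Qed.

(* A strong limit of elements of [M] commutes with the commutant of [M], hence
   lies in the bicommutant. *)
Let memE : M E.
Proof.
have [_ <-] := wstar_von_neumann W; split; first by case: projE.
move=> y [yb yM]; apply/funext => v /=; apply: (strong_limit_commute hn a_sa a_semigroup a_ge0 a_noninc) => // n w.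
by have := yM (a n) (opalg_mem _) => /(congr1 (@^~ w)).
Qed.

Let Re_E_le n v : Re (dot (E v) v) <= Re (dot (a n v) v).
Proof.
have := @cvg_Re_strong_limit _ _ _ hn a a_sa a_semigroup a_ge0 a_noninc v.
have ni : nonincreasing_seq (fun n => Re (dot (a n v) v)).
  by apply/nonincreasing_seqP => k; exact: a_noninc.
by move=> h; rewrite -/E -(cvg_lim (@norm_hausdorff _ _) h); apply: nonincreasing_cvgn_ge => //; exact: cvgP h.
Qed.

Let sa_ge0 (x : H -> H) v : self_adjoint dot x -> 0 <= Re (dot (x v) v) -> 0 <= dot (x v) v.
Proof.
move=> xs x0; rewrite lecE /= x0 andbT.
have := dot_conj dot (x v) v; rewrite -xs; case: (dot (x v) v) => r s /= [/eqP].
by rewrite -addr_eq0 -mulr2n mulrn_eq0.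
Qed.

Let e : A := exist _ E (mem_set memE).
Let c n : A := 1 - pword D 0 n.*2.+1.

Let sa_sub (x y : A) : self_adjoint dot (val x) -> self_adjoint dot (val y) ->
  self_adjoint dot (val (x - y)).
Proof. by move=> xs ys v w; rewrite !opalg_valB linearBl linearBr /= xs ys. Qed.

Let sa1 : self_adjoint dot (val (1 : A)). Proof. by []. Qed.
Let saE : self_adjoint dot (val e). Proof. by case: projE. Qed.
Let sac n : self_adjoint dot (val (c n)). Proof. exact: (sa_sub sa1 (a_sa n)). Qed.

Let op_le_opalg (x y : A) : self_adjoint dot (val x) -> self_adjoint dot (val y) ->
  (forall v, Re (dot (val x v) v) <= Re (dot (val y v) v)) -> op_le dot (val x) (val y).
Proof.
move=> xs ys xy v; rewrite -opalg_valB; apply: (sa_ge0 (sa_sub ys xs)).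
by rewrite opalg_valB linearBl ReB subr_ge0; exact: xy.
Qed.

Let Re_dot1B (x : A) v : Re (dot (val (1 - x) v) v) = sqnorm v - Re (dot (val x v) v).
Proof. by rewrite opalg_valB linearBl /= ReB. Qed.

(** Normality of the state, applied to the increasing sequence [1 - a n] whose
    least upper bound is the complement of the meet. *)
Lemma tau_meet_glb : exists l : R,
  [/\ tau (meet_projection dot (val p) (val q)) = l%:C,
      forall n, l <= moment tr D n &
      forall r : R, (forall n, r <= moment tr D n) -> r <= l].
Proof.
rewrite meet_projection_strong_limit.
have mE n : tr (pword D 0 n.*2.+1) = (moment tr D n)%:C.
  by rewrite (tr_pword TS projD tr_qp) /= uphalf_double.
have lub : is_lub_sa dot M [set val (c n) | n in setT] (val (1 - e)).
  split.
  - exact: opalg_mem.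
  - exact: (sa_sub sa1 saE).
  - move=> _ [n _ <-]; apply: (op_le_opalg (sac n) (sa_sub sa1 saE)) => v.
    by rewrite !Re_dot1B lerB // Re_E_le.
  - move=> b Mb bs bu; rewrite -(to_opalgK W Mb) in bs bu *.
    apply: op_le_opalg => // [|v]; first exact: (sa_sub sa1 saE).
    rewrite Re_dot1B lerBlDr -lerBlDl.
    have h := @cvg_Re_strong_limit _ _ _ hn a a_sa a_semigroup a_ge0 a_noninc v.
    rewrite -/E -(cvg_lim (@norm_hausdorff _ _) h); apply: limr_ge; first exact: cvgP h.
    apply: nearW => n; have := bu (val (c n)) (ex_intro2 _ _ n I erefl) v.
    move=> /ge0_Re; rewrite linearBl ReB Re_dot1B; lra.
have cM n : M (val (c n)) := opalg_mem _.
have := state_normal (wstar_state W) _ _ _ lub.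
have c_le n k : (n <= k)%N -> op_le dot (val (c n)) (val (c k)).
  move=> nk; apply: (op_le_opalg (sac n) (sac k)) => v.
  rewrite /c !Re_dot1B lerB //.
  elim: k nk => [|k IH]; first by rewrite leqn0 => /eqP ->.
  by rewrite leq_eqVlt => /predU1P[->//|/IH]; apply: le_trans; exact: a_noninc.
case=> [|x [n _ <-]|x y [n _ <-] [k _ <-]|ub lb].
- by exists (val (c 0)), 0%N.
- by split; [exact: cM|exact: sac].
- exists (val (c (maxn n k))); split; first by exists (maxn n k).
    by apply: c_le; exact: leq_maxl.
  by apply: c_le; exact: leq_maxr.
have tau1B (x : A) : tau (val (1 - x)) = 1 - tr x.
  by rewrite -(tr1 TS) -(trB TS).
have le_m n : tau E <= (moment tr D n)%:C.
  have : tau (val (c n)) <= tau (val (1 - e)).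
    by apply: ub; exists (val (c n)) => //; exists n.
  by rewrite !tau1B mE lerD2l lerN2.
have EE : tau E = (Re (tau E))%:C.
  by have := le_m 0; rewrite lecE; case: (tau E) => s r /= /andP[/eqP <-].
exists (Re (tau E)); split => // [n|r rm].
  by rewrite -lecR -EE.
rewrite -lecR -EE.
have : tau (val (1 - e)) <= 1 - r%:C.
  apply: lb => _ [_ [n _ <-] <-]; rewrite tau1B mE lerD2l lerN2 lecR; exact: rm.
by rewrite tau1B lerD2l lerN2.
Qed.
End MeetTrace.

(** * The liberation of P by a free unitary Brownian motion *)

(** The mean and the second moment of the Brownian motion at time [h]. *)
Lemma expR_laguerre1 (R : realType) (h : R) :
  expR (- (1%:R * h) / 2) / 1%:R * laguerre1 0 (1%:R * h) = expR (- h / 2) /\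
  expR (- (2%:R * h) / 2) / 2%:R * laguerre1 1 (2%:R * h) = expR (- h) * (1 - h).
Proof.
rewrite /laguerre1 !big_ord_recr !big_ord0 /= !mul1r; split.
  by rewrite fact0 !(invr1, mulr1, add0r).
have -> : - (2 * h) / 2 = - h by field.
rewrite subn0 subnn bin1 bin0 expr0 !expr1 fact0 (_ : 1`! = 1)%N //.
by field.
Qed.
Section Evolution.
Context {R : realType} {H : completeNormedModType R[i]}.
Variable dot : {dot H for (@Num.conj R[i])}.
Variables (M : set (H -> H)) (tau : (H -> H) -> R[i]).
Hypothesis W : wstar_probability_space dot M tau.
Variables (P : H -> H) (theta : R).
Hypotheses (MP : M P) (projP : orthogonal_projection dot P).
Hypothesis tauP : tau P = theta%:C.
Variable Y : R -> H -> H.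
Hypothesis fubmY : free_unitary_brownian_motion dot M tau Y.
Hypothesis freeYP : star_free_from dot tau Y P.
Implicit Types (s t h : R) (a : opalg W).
Local Notation A := (opalg W).
Local Notation star := (@opstar _ _ _ _ _ W).
Local Notation tr := (@optr _ _ _ _ _ W).
Let TS : tracial_star_algebra star tr := opalg_tracial W.

Let p : A := to_opalg W P.
Let valp : val p = P. Proof. exact: to_opalgK. Qed.
Let y t : A := to_opalg W (Y t).
Let valy t : 0 <= t -> val (y t) = Y t.
Proof. by move=> t0; apply: to_opalgK; exact: (fubm_mem fubmY). Qed.

Let pp : is_projection star p. Proof. by apply: opalg_projection; rewrite valp. Qed.

Let val_star (a : A) : val (star a) = adj dot (val a). Proof. by []. Qed.

Let yVy t : 0 <= t -> star (y t) * y t = 1.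
Proof.
by move=> t0; apply: val_inj; rewrite opalg_valM val_star valy //; case: (fubm_unitary fubmY t0).
Qed.

Let yyV t : 0 <= t -> y t * star (y t) = 1.
Proof.
by move=> t0; apply: val_inj; rewrite opalg_valM val_star valy //; case: (fubm_unitary fubmY t0).
Qed.

(** The pair of projections at time [t]: [P] and its conjugate by [Y t]. *)
Definition freed t (b : bool) : A := if b then y t * p * star (y t) else p.
Local Notation m := (fun n t => moment tr (freed t) n).

Let proj_freed t b : 0 <= t -> is_projection star (freed t b).
Proof.
move=> t0; case: b => //; case: pp => ps pi; split.
  by rewrite /freed !(starM TS) (starK TS) ps mulrA.
by rewrite /freed !mulrA -(mulrA _ (star _)) yVy // mulr1 -(mulrA _ p p) pi.
Qed.

Let tr_freed t : 0 <= t -> tr (freed t true) = tr (freed t false).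
Proof. by move=> t0; rewrite /freed (trC TS) mulrA yVy // mul1r. Qed.

Let trp : tr p = theta%:C. Proof. by rewrite /optr valp. Qed.

Section Step.
Variables (t h : R).
Hypotheses (t0 : 0 <= t) (h0 : 0 < h).

Let th0 : 0 <= t + h. Proof. by rewrite addr_ge0 // ltW. Qed.
Let Z : A := y (t + h) * star (y t).
Let z (b : bool) : A := if b then star Z else Z.

Let valZ : val Z = Y (t + h) \o adj dot (Y t).
Proof. by rewrite opalg_valM val_star !valy. Qed.

Let Yall := [set Y t | t in [set t : R | 0 <= t]].
Let YallM : Yall `<=` M. Proof. by move=> _ [s s0 <-]; exact: (fubm_mem fubmY). Qed.
Let genY s : 0 <= s -> generated Yall (y s).
Proof. by move=> s0; apply: generated_gen; rewrite valy //; exists s. Qed.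

Let genZ : generated Yall Z.
Proof.
apply: (subalgM (generated_subalgebra W YallM)); first exact: genY.
by apply: generated_star; exact: genY.
Qed.

Let old (b : bool) : A -> Prop := if b then generated [set Y t] else generated [set P].
Let new : A -> Prop := generated [set val Z].

(** [Y t] and the increment are free by hypothesis, and both lie in the algebra
    generated by the whole Brownian motion, which is free from [P]. *)
Lemma increment_free :
  free_family tr (fun o : option bool => if o is Some b then old b else new).
Proof.
pose BUZ (b : bool) : A -> Prop := if b then generated [set Y t] else generated [set val Z].
have F1 : free_family tr (fun b : bool => if b then generated (W := W) Yall else generated [set P]).
  have FY := free_family_generated (W := W) freeYP.
  by apply: (free_relabel (f := id) _ _ FY) => // -[].
have F2 : free_family tr BUZ.
  pose inc (k : nat) := if k is 0%N then t else t + h.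
  have inc_lt k : (k.+1 < 2)%N -> inc k < inc k.+1 by case: k => [|//] _; rewrite /= ltrDl.
  have F := fubm_free_increments fubmY (n := 2) (t := inc) t0 inc_lt.
  have FZ := free_family_generated (W := W) F.
  apply: (free_relabel (f := fun b : bool => if b then ord0 else lift ord0 ord0 : 'I_2) _ _ FZ)
    => [[] [] //|[] a //].
  by rewrite /BUZ valZ.
have BC b a : BUZ b a -> generated Yall a.
  case: b; apply: generated_sub => x ->; last exact: genZ.
  by rewrite -valy //; exact: genY.
have F3 := free_assoc BC (subalgM (generated_subalgebra W YallM)) F2 F1.
pose f (o : option bool) : option bool :=
  match o with None => Some false | Some true => Some true | Some false => None end.
by apply: (free_relabel (f := f) _ _ F3) => [[[]|] [[]|]|[[]|]].
Qed.

Let old_sub b : subalgebra (old b).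
Proof.
by case: b; apply: generated_subalgebra => x -> //; exact: (fubm_mem fubmY).
Qed.

Let new_sub : subalgebra new.
Proof. by apply: generated_subalgebra => x ->; exact: opalg_mem. Qed.

Let span_freed b a : alg_span tr old a -> alg_span tr old (freed t b * a).
Proof.
have sp x : alg_span tr old x -> alg_span tr old (p * x).
  by apply: (span_mul TS (i := false)) => //; apply: generated_gen; rewrite valp.
have oy : old true (y t) by apply: generated_gen; rewrite valy.
case: b => oa; last exact: sp.
rewrite -!mulrA; apply: (span_mul TS old_sub oy); apply: sp.
by apply: (span_mul TS old_sub (i := true)) => //; exact: generated_star.
Qed.

Let star_z b : star (z b) = z (~~ b).
Proof. by case: b => //=; rewrite (starK TS). Qed.

Let zzN b : z b * z (~~ b) = 1.
Proof.
case: b; rewrite /= /Z (starM TS) (starK TS) !mulrA.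
  by rewrite -(mulrA (y t)) yVy // mulr1 yyV.
by rewrite -(mulrA (y (t + h))) yVy // mulr1 yyV.
Qed.

Let new_z b : new (z b).
Proof.
have nZ : new Z by apply: generated_gen.
by case: b => //; exact: generated_star.
Qed.

Let law w : tau (star_word dot w (val Z)) = tau (star_word dot w (Y h)).
Proof.
have := fubm_stationary fubmY t0 (_ : t < t + h); rewrite ltrDl => /(_ h0) /(_ w).
by rewrite valZ (addrC t) addrK.
Qed.

Let val_z b : val (z b) = if ~~ b then val Z else adj dot (val Z).
Proof. by case: b. Qed.

Let tr_z b : tr (z b) = (expR (- h / 2))%:C.
Proof.
have [] := fubm_moments fubmY (ltW h0) (isT : (0 < 1)%N).
rewrite (expR_laguerre1 h).1 => <- e.
have := law [:: ~~ b]; rewrite /star_word !big_cons !big_nil -val_z => L.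
by rewrite [LHS]L; case: b {L}.
Qed.

Let tr_zz b : tr (z b * z b) = (expR (- h) * (1 - h))%:C.
Proof.
have [] := fubm_moments fubmY (ltW h0) (isT : (0 < 2)%N).
rewrite (expR_laguerre1 h).2 => <- e.
have := law [:: ~~ b; ~~ b]; rewrite /star_word !big_cons !big_nil -val_z => L.
by rewrite [LHS]L; case: b {L}.
Qed.

Let freed_step : freed (t + h) = liberate (freed t) z.
Proof.
apply/funext => -[] //=; rewrite /freed /= /Z (starM TS) (starK TS) !mulrA.
rewrite -(mulrA (y (t + h)) (star (y t)) (y t)) yVy // mulr1.
by rewrite -(mulrA _ (star (y t)) (y t)) yVy // mulr1.
Qed.

Lemma moment_step N : h <= 4^-1 ->
  `|m N.+1 (t + h) - m N.+1 t + h * (N.+1%:R * (m N.+1 t -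
      \sum_(k < N.+1) m k t * m (N - k)%N t + \sum_(k < N) m k.+1 t * m (N - k)%N t))| <=
  step_const R N * (h * Num.sqrt h).
Proof.
move=> h4; cbv beta; rewrite freed_step.
apply: (moment_liberation_step TS _ _ increment_free new_sub span_freed new_z) => //.
- by move=> b; exact: proj_freed.
- exact: tr_freed.
- by rewrite ltW.
Qed.
End Step.

Let m0 t : 0 <= t -> m 0 t = theta.
Proof. by move=> t0; rewrite /moment /= mulr1 trp. Qed.

Let m_start n : m n 0 = theta.
Proof.
have y0 : y 0 = 1.
  by apply: val_inj; rewrite valy // (fubm_start fubmY).
have D b : freed 0 b = p by case: b; rewrite // /freed y0 (star1 TS) mul1r mulr1.
rewrite /moment; suff -> : pword (freed 0) 0 n.*2.+1 = p by rewrite trp.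
elim: n.*2 0%N => [|k IH] i; first by rewrite /= mulr1 D.
by rewrite -[LHS]/(freed 0 (odd i) * pword (freed 0) i.+1 k.+1) IH D pp.2.
Qed.

Let m_ge0 n t : 0 <= t -> 0 <= m n t.
Proof. by move=> t0; apply: (moment_ge0 TS) (tr_freed t0) n => b; exact: proj_freed. Qed.
Let m_noninc n t : 0 <= t -> m n.+1 t <= m n t.
Proof. by move=> t0; apply: (moment_noninc TS) (tr_freed t0) n => b; exact: proj_freed. Qed.
Let m_le1 n t : 0 <= t -> m n t <= 1.
Proof. by move=> t0; apply: (moment_le1 TS) (tr_freed t0) n => b; exact: proj_freed. Qed.

Lemma decayE N t : 0 <= t -> decay theta m N.+1 t =
  m N.+1 t - \sum_(k < N.+1) m k t * m (N - k)%N t + \sum_(k < N) m k.+1 t * m (N - k)%N t.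
Proof.
move=> t0; rewrite /decay /mconv [X in _ + X]big_ord_recl [X in _ + (_ + X)]big_ord_recr /=.
rewrite /bump /= subSS subnn subn0 !add1n (m0 t0).
under [X in _ + (_ + (X + _))]eq_bigr => k _ do rewrite /bump /= add1n subSS.
ring.
Qed.

(** The theorem on one step of liberation, read as a forward derivative: its
    constant depends on the order of the moment only. *)
Lemma moment_flow n T : fwd_deriv T (m n) (fun t => - (n%:R * decay theta m n t)).
Proof.
case: n => [|N].
  apply: fwd_deriv_ext (fwd_deriv_cst T theta) => t /andP[t0 _]; first by rewrite m0.
  by rewrite mul0r oppr0.
exists (1 + N.+1%:R * (1 + N.+1%:R + N.+1%:R) + step_const R N) => t /andP[t0 tT].
have sc0 : 0 <= step_const R N by rewrite addr_ge0 // !mulr_ge0 ?exprn_ge0.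
have b1 n : `|m n t| <= 1 by rewrite ger0_norm ?m_ge0 ?m_le1.
have bs n (f g : nat -> nat) : (n <= N.+1)%N ->
    `|\sum_(k < n) m (f k) t * m (g k) t| <= N.+1%:R.
  move=> nN; apply: (@le_trans _ _ n%:R); last by rewrite ler_nat.
  rewrite -[n in n%:R]card_ord -sumr_const; apply: le_trans (ler_norm_sum _ _ _) _.
  by apply: ler_sum => k _; rewrite normrM -[1]mulr1 ler_pM.
have N0 : 0 <= N.+1%:R :> R by [].
split.
- by rewrite (le_trans (b1 _)) //; nra.
- rewrite decayE // normrN normrM (ger0_norm N0).
  have B : `|m N.+1 t - \sum_(k < N.+1) m k t * m (N - k)%N t +
      \sum_(k < N) m k.+1 t * m (N - k)%N t| <= 1 + N.+1%:R + N.+1%:R.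
    rewrite (le_trans (ler_normD _ _)) // lerD ?(bs N succn (fun k => N - k)%N) //.
    rewrite (le_trans (ler_normB _ _)) // lerD ?b1 //.
    exact: (bs N.+1 id (fun k => N - k)%N).
  by rewrite (le_trans (ler_wpM2l N0 B)) //; lra.
- move=> h /andP[h0 h4] _; have q0 : 0 <= h * Num.sqrt h by rewrite mulr_ge0 ?sqrtr_ge0.
  have [->|hn0] := eqVneq h 0.
    by rewrite addr0 subrr !mul0r subr0 normr0 mulr0.
  have hp : 0 < h by rewrite lt_def hn0.
  rewrite decayE // mulrN opprK; apply: le_trans (moment_step t0 hp N h4) _.
  by rewrite ler_wpM2r // lerDr; nra.
Qed.

Lemma tau_conjugate t : 0 <= t -> tau (Y t \o P \o adj dot (Y t)) = theta%:C.
Proof.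
move=> t0; have -> : Y t \o P \o adj dot (Y t) = val (freed t true).
  by rewrite /freed !opalg_valM valp val_star !valy.
by rewrite -[LHS]/(tr (freed t true)) tr_freed // trp.
Qed.

(** The trace of the meet is the greatest lower bound of the moments; the two
    values 0 and [2 theta - 1] are lower bounds, and [moment_limit_le] leaves
    no other possibility. *)
Lemma tau_meet t : 0 < t -> theta <= 1 ->
  tau (meet_projection dot P (Y t \o P \o adj dot (Y t))) = (Num.max (2 * theta - 1) 0)%:C.
Proof.
move=> t_gt0 th1; have t0 := ltW t_gt0.
have -> : Y t \o P \o adj dot (Y t) = val (freed t true).
  by rewrite /freed !opalg_valM valp val_star !valy.
rewrite -[in meet_projection _ P]valp.
have pf := fun b => proj_freed b t0.
have [l [-> lm lg]] := tau_meet_glb pp (pf true) (tr_freed t0); congr (_%:C).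
have fE : (fun b : bool => if b then freed t true else p) = freed t by apply/funext => -[].
rewrite fE in lm lg.
have l0 : 0 <= l by apply: lg => n; exact: m_ge0.
have l1 : 2 * theta - 1 <= l.
  apply: lg => n; have := moment_lower TS pf (tr_freed t0) n.
  by rewrite (_ : freed t false = p) // trp /=; lra.
apply/eqP; rewrite eq_le ge_max l0 l1 !andbT le_max.
have [->|ln0] := eqVneq l 0; first by rewrite lexx orbT.
have lp : 0 < l by rewrite lt_def ln0.
have := moment_limit_le th1 m0 m_start m_ge0 m_noninc moment_flow t_gt0 lp lm.
by rewrite mulr_natl => ->.
Qed.
End Evolution.

(** The conjugate projection has the trace of [P], so both claims express
    [tau_meet]. *)
Theorem theorem1 (R : realType) (H : completeNormedModType R[i])
    (dot : {dot H for (@Num.conj R[i])})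
    (M : set (H -> H)) (tau : (H -> H) -> R[i])
    (wstar : wstar_probability_space dot M tau)
    (P : H -> H) (theta : R)
    (MP : M P) (projP : orthogonal_projection dot P)
    (tauP : tau P = theta%:C) (theta_gt0 : 0 < theta) (theta_lt1 : theta < 1)
    (Y : R -> H -> H) (fubmY : free_unitary_brownian_motion dot M tau Y)
    (freeYP : star_free_from dot tau Y P)
    (t : R) (t_gt0 : 0 < t) :
  let Q := Y t \o P \o adj dot (Y t) in
  general_position dot tau P Q /\
  tau (meet_projection dot P Q) = (Num.max (2 * theta - 1) 0)%:C.

Proof.
move=> Q.
have E : tau (meet_projection dot P Q) = (Num.max (2 * theta - 1) 0)%:C.
  exact: (tau_meet wstar MP projP tauP fubmY freeYP t_gt0 (ltW theta_lt1)).
split=> //; rewrite /general_position E.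
have -> : tau Q = theta%:C.
  exact: (tau_conjugate wstar MP tauP fubmY (ltW t_gt0)).
by rewrite tauP real_complex_max mulr_natl mulr2n rmorphB rmorph1 rmorphD.
Qed.
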